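(* Let $\mathbb{K}$ be a field of characteristic $p>0$ and $A=\mathfrak{U}_3^+(\mathbb{K})$, graded by the free commutative monoid $S$ on $\alpha,\beta$. The part $$P_1\xrightarrow{d_1}P_0\xrightarrow{d_0}P_{-1}\xrightarrow{\varepsilon}\mathbb{K}\to 0$$ of the Anick resolution of $\mathbb{K}$ with respect to the Gröbner basis $G$ gives the first two steps of the minimal ($S$-graded) projective resolution of the trivial module $\mathbb{K}$; that is, the image of $d_0$ is a small submodule of $P_{-1}$ and the image of $d_1$ is a small submodule of $P_0$.
   Context: Algebra. Let $sl_3^+$ be the Lie algebra of strictly upper triangular complex $3\times 3$ matrices with basis $e_\alpha=E_{12}$, $e_{\alpha+\beta}=E_{13}$, $e_\beta=E_{23}$, $\mathfrak{U}_3^+(\mathbb{C})$ its enveloping algebra, $e_\omega^{(k)}=\frac1{k!}e_\omega^k$. $\mathfrak{U}_3^+(\mathbb{Z})$ is the $\mathbb{Z}$-span of all $e_\alpha^{(i)}e_{\alpha+\beta}^{(j)}e_\beta^{(l)}$, $i,j,l\ge0$ (a subring), and $A=\mathfrak{U}_3^+(\mathbb{K})=\mathbb{K}\otimes_{\mathbb{Z}}\mathfrak{U}_3^+(\mathbb{Z})$. $A$ is graded by $S$ via $\deg(e_\alpha^{(i)}e_{\alpha+\beta}^{(j)}e_\beta^{(l)})=(i+j)\alpha+(j+l)\beta$, and $A_0=\mathbb{K}$. Let $\varepsilon\colon A\to\mathbb{K}$ be the projection onto $A_0$; it makes $\mathbb{K}$ the trivial module. $A$ is generated by $Z=\{a_l,b_l\mid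 l\ge0\}$, $a_l=e_\alpha^{(p^l)}$, $b_l=e_\beta^{(p^l)}$. Gröbner basis. Order $Z^*$ (words in $Z$) first by $\mathrm{Deg}$, where $\mathrm{Deg}(a_l)=\mathrm{Deg}(b_l)=p^l$ additively, then lexicographically with $a_0<b_0<a_1<b_1<\cdots$. The reduced Gröbner basis $G$ of the kernel of $\mathbb{K}\langle Z^*\rangle\to A$ consists of: $a_lb_k - b_ka_l + (-1)^{l-k}a_k^{p-1}b_ka_ka_{k+1}^{p-1}\cdots a_{l-1}^{p-1}$, $b_la_k - a_kb_l - (-1)^{l-k}b_ka_kb_k^{p-1}b_{k+1}^{p-1}\cdots b_{l-1}^{p-1}$, $a_la_k-a_ka_l$, $b_lb_k-b_kb_l$ for $0\le k<l$; $(b_ka_k)^p-(a_kb_k)^p$, $a_k^p$, $b_k^p$ for $k\ge0$; and, if $p\ge3$, $b_k^2a_k-2b_ka_kb_k+a_kb_k^2$, $b_ka_k^2-2a_kb_ka_k+a_k^2b_k$ for $k\ge0$ (in each case the first written monomial is the leading one). $M$ is the set of words containing no leading monomial of $G$ as a subword; its image is a basis of $A$, and for $f\in\mathbb{K}\langle Z^*\rangle$, $NF(f)$ is the unique linear combination of words in $M$ with the same image in $A$. Anick resolution (initial part). $T_{-1}=\{e\}$, $T_0=Z$, $T_1$ is the set of leading monomials of elements of $G$. $P_k$ is the free left $A$-module with basis $\{.t\mid t\in T_k\}$, with $.t$ in degree $\deg(t)$ and $.e$ in degree $0$; a $\mathbb{K}$-basis is $\{m.t\mid m\in M,t\in T_k\}$.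 $\varepsilon\colon P_{-1}=A\to\mathbb{K}$ is the projection of $A$ onto its degree-$0$ component $A_0=\mathbb{K}$ (where $P_{-1}$ is identified with $A$ via $.e\mapsto 1$), $d_0(.x)=x.e$ for $x\in Z$. Let $i_0$ be the $\mathbb{K}$-linear map from $\ker\varepsilon\subset P_{-1}$ to $P_0$ with $i_0(ux.e)=u.x$ for $ux\in M$, $x\in Z$. For $t=t'x\in T_1$ with $x\in Z$, $d_1(.t)=t'.x-i_0(NF(t).e)$. Smallness and minimality. A graded submodule $N$ of a graded module $P$ is small if $T+N=P$ implies $T=P$ for every graded submodule $T\subset P$. A graded projective resolution is minimal if the image of each differential is small in its target (equivalently the kernel of each map, including the augmentation, is small). *)

(* Defs.v *)
From HB Require Import structures.
From mathcomp Require Import all_boot all_order all_algebra.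
From mathcomp Require Import boolp classical_sets reals.
From mathcomp Require Import finmap complex monalg.

Set Implicit Arguments.
Unset Strict Implicit.
Unset Printing Implicit Defensive.

Import Order.TTheory GRing.Theory Num.Theory.
Local Open Scope ring_scope.
Local Open Scope complex_scope.

Section StrictlyUpperTriangular.
Variable F : fieldType.

Definition strict_upper (m : 'M[F]_3) : bool :=
  [forall i : 'I_3, forall j : 'I_3, (j <= i)%N ==> (m i j == 0)].

Lemma strict_upperP (m : 'M[F]_3) :
  reflect (forall i j : 'I_3, (j <= i)%N -> m i j = 0) (strict_upper m).
Proof.
apply: (iffP forallP) => [h i j ji|h i].
  by have /forallP/(_ j)/implyP/(_ ji)/eqP := h i.
by apply/forallP => j; apply/implyP => ji; apply/eqP/h.
Qed.

Lemma strict_upper_submod : submod_closed strict_upper.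
Proof.
split; first by apply/strict_upperP => i j _; rewrite mxE.
move=> a u v /strict_upperP hu /strict_upperP hv.
by apply/strict_upperP => i j ji; rewrite !mxE hu // hv // mulr0 addr0.
Qed.

HB.instance Definition _ :=
  GRing.isSubmodClosed.Build F 'M[F]_3 strict_upper strict_upper_submod.

Record sl3p : predArgType :=
  Sl3p { sl3p_mx : 'M[F]_3; sl3p_mxP : strict_upper sl3p_mx }.

HB.instance Definition _ := [isSub for sl3p_mx].
HB.instance Definition _ := [Choice of sl3p by <:].
HB.instance Definition _ := [SubChoice_isSubLmodule of sl3p by <:].

Lemma strict_upperM (x y : sl3p) : strict_upper (val x *m val y).
Proof.
have /strict_upperP hx := sl3p_mxP x; have /strict_upperP hy := sl3p_mxP y.
apply/strict_upperP => i j ji; rewrite mxE big1 // => k _.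
have [ki|ik] := leqP k i; first by rewrite hx // mul0r.
by rewrite (hy k j) ?mulr0 // (leq_trans ji) // ltnW.
Qed.

Definition sl3p_lie (x y : sl3p) : sl3p :=
  Sl3p (rpredB (strict_upperM x y) (strict_upperM y x)).

Lemma strict_upper_delta (i j : 'I_3) :
  (i < j)%N -> strict_upper (delta_mx i j).
Proof.
move=> ij; apply/strict_upperP => i' j' ji; rewrite mxE.
by case: eqP => //= ii; case: eqP => //= jj; move: ij; rewrite -ii -jj ltnNge ji.
Qed.

Definition E12 : sl3p := @Sl3p (delta_mx 0 1) (@strict_upper_delta 0 1 isT).
Definition E13 : sl3p := @Sl3p (delta_mx 0 2%:R) (@strict_upper_delta 0 2%:R isT).
Definition E23 : sl3p := @Sl3p (delta_mx 1 2%:R) (@strict_upper_delta 1 2%:R isT).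

Definition is_lie_hom (B : algType F) (f : sl3p -> B) : Prop :=
  forall x y, f (sl3p_lie x y) = f x * f y - f y * f x.

(* Universal property: [(U, iota)] is the enveloping algebra of [sl3p]. *)
Definition is_enveloping (U : algType F) (iota : {linear sl3p -> U}) : Prop :=
  is_lie_hom iota /\
  forall (B : algType F) (f : {linear sl3p -> B}), is_lie_hom f ->
    exists h : {lrmorphism U -> B},
      (forall x, h (iota x) = f x) /\
      forall h' : {lrmorphism U -> B}, (forall x, h' (iota x) = f x) -> h' =1 h.

End StrictlyUpperTriangular.

Section IntegralForm.
Variables (F : fieldType) (U : algType F) (iota : {linear sl3p F -> U}).

Definition divpow (x : sl3p F) (k : nat) : U := (k`!%:R)^-1 *: iota x ^+ k.

Definition pbw (m : nat * nat * nat) : U :=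
  divpow (E12 F) m.1.1 * divpow (E13 F) m.1.2 * divpow (E23 F) m.2.

Definition U3Z : set U :=
  [set u | exists f : {malg int[(nat * nat * nat)%type]},
     u = \sum_(m <- msupp f) pbw m *~ f@_m].

(* [A] together with [phi : u |-> 1 (x) u] is the scalar extension
   [K (x)_Z U3Z].  Since [U3Z] is a subset of [U], [phi] is a function on [U]
   of which only the restriction to [U3Z] is meaningful; the same holds of [f]
   in the universal property of the tensor product. *)
Record is_scalar_extension (K : fieldType) (A : algType K) (phi : U -> A) :
    Prop := {
  phi1 : phi 1 = 1;
  phiD : forall u v, U3Z u -> U3Z v -> phi (u + v) = phi u + phi v;
  phiM : forall u v, U3Z u -> U3Z v -> phi (u * v) = phi u * phi v;
  phi_universal : forall (V : lmodType K) (f : U -> V),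
    (forall u v, U3Z u -> U3Z v -> f (u + v) = f u + f v) ->
    exists g : {linear A -> V}, (forall u, U3Z u -> g (phi u) = f u) /\
      forall g' : {linear A -> V},
        (forall u, U3Z u -> g' (phi u) = f u) -> g' =1 g
}.

End IntegralForm.

Section Small.
Variables (R : nzRingType) (P : lmodType R) (S : Type).
(* [H d] is the homogeneous component of degree [d] of [P]. *)
Variable H : S -> set P.

Definition graded_submodule (N : set P) : Prop :=
  [/\ N 0,
      forall (a : R) u v, N u -> N v -> N (a *: u + v) &
      forall v, N v -> exists s : seq P,
        (forall w, w \in s -> N w /\ exists d, H d w) /\ v = \sum_(w <- s) w].

Definition small (N : set P) : Prop :=
  graded_submodule N /\
  forall T : set P, graded_submodule T ->
    (forall v, exists t n, [/\ T t, N n & v = t + n]) -> forall v, T v.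

End Small.

(* [(false, l)] is the letter a_l and [(true, l)] is the letter b_l. *)
Notation letter := (bool * nat)%type.
Notation word := {fmonom letter}.

Section Words.
Variable p : nat.

Definition letter_rank (x : letter) : nat := (x.2.*2 + x.1)%N.

Definition word_Deg (w : word) : nat := \sum_(x <- w) p ^ x.2.

Definition word_le (u v : word) : bool :=
  (word_Deg u < word_Deg v)%N ||
  (word_Deg u == word_Deg v) &&
  (map letter_rank u <= map letter_rank v :> seqlexi nat)%O.

(* The free commutative monoid on alpha, beta is [nat * nat], additively. *)
Definition letter_deg (x : letter) : nat * nat :=
  if x.1 then (0, p ^ x.2)%N else (p ^ x.2, 0)%N.

Definition word_deg (w : word) : nat * nat := \sum_(x <- w) letter_deg x.

Variable K : fieldType.

Definition la (l : nat) : {malg K[word]} := << fmu (false, l) >>.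
Definition lb (l : nat) : {malg K[word]} := << fmu (true, l) >>.

Definition G : set {malg K[word]} := [set g |
  (exists k l, (k < l)%N /\
    [\/ g = la l * lb k - lb k * la l
            + (-1) ^+ (l - k) *: (la k ^+ p.-1 * lb k * la k
                                  * \prod_(k.+1 <= i < l) la i ^+ p.-1),
        g = lb l * la k - la k * lb l
            - (-1) ^+ (l - k) *: (lb k * la k * \prod_(k <= i < l) lb i ^+ p.-1),
        g = la l * la k - la k * la l |
        g = lb l * lb k - lb k * lb l]) \/
  (exists k,
    [\/ g = (lb k * la k) ^+ p - (la k * lb k) ^+ p,
        g = la k ^+ p |
        g = lb k ^+ p]) \/
  ((3 <= p)%N /\ exists k,
    g = lb k ^+ 2 * la k - 2%:R *: (lb k * la k * lb k) + la k * lb k ^+ 2 \/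
    g = lb k * la k ^+ 2 - 2%:R *: (la k * lb k * la k) + la k ^+ 2 * lb k)].

Definition is_lead (g : {malg K[word]}) (t : word) : Prop :=
  t \in msupp g /\ forall w, w \in msupp g -> word_le w t.

Definition T1 : set word := [set t | exists2 g, G g & is_lead g t].

Definition M : set word := [set w | forall t, T1 t -> ~~ infix t w].

End Words.

Section Anick.
Variables (F : fieldType) (U : algType F) (iota : {linear sl3p F -> U}).
Variables (K : fieldType) (p : nat) (A : algType K) (phi : U -> A).

Definition A_deg (s : nat * nat) : set A :=
  [set x | exists f : {malg K[(nat * nat * nat)%type]},
     (forall m, m \in msupp f -> (m.1.1 + m.1.2, m.1.2 + m.2)%N = s) /\
     x = \sum_(m <- msupp f) f@_m *: phi (pbw iota m)].

Definition letter_val (x : letter) : A :=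
  phi (divpow iota (if x.1 then E23 F else E12 F) (p ^ x.2)).

Definition word_val (w : word) : A := \prod_(x <- w) letter_val x.

Definition poly_val (f : {malg K[word]}) : A :=
  \sum_(w <- msupp f) f@_w *: word_val w.

(* The coordinates of [v] in the basis of [A] given by [M]. *)
Definition M_coord (v : A) : {malg K[word]} :=
  xget 0 [set f | (forall w, w \in msupp f -> M p K w) /\ poly_val f = v].

Definition NF (f : {malg K[word]}) : {malg K[word]} := M_coord (poly_val f).

(* The free graded module on a basis [T]; P_{-1} is the regular module [A^o],
   its basis element .e being [1]. *)
Definition free_deg (T : choiceType) (deg : T -> nat * nat)
    (s : nat * nat) : set {malg A[T]} :=
  [set v | forall t, v@_t = 0 \/ exists2 r : nat * nat, r + deg t = s & A_deg r v@_t].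

(* The word [u x] is sent to [u.x]. *)
Definition split_last (w : word) : {malg A[letter]} :=
  if fmonom_val w is x :: s
  then << word_val (FMonom (belast x s)) *g last x s >> else 0.

(* Extended from the kernel of the augmentation to all of [A] by sending
   the empty word to 0. *)
Definition i0 (v : A^o) : {malg A[letter]} :=
  \sum_(w <- msupp (M_coord v)) ((M_coord v)@_w)%:A *: split_last w.

Definition d0 (v : {malg A[letter]}) : A^o :=
  \sum_(x <- msupp v) v@_x *: (letter_val x : A^o).

Definition d1_basis (t : word) : {malg A[letter]} :=
  split_last t - i0 (poly_val (NF << t >>)).

Definition d1 (v : {malg A[T1 p K]}) : {malg A[letter]} :=
  \sum_(t <- msupp v) v@_t *: d1_basis (val t).

End Anick.

(* Main.v *)
(** A is identified with the free K-module on the PBW exponents, with the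
    structure constants of the divided powers. The letters are linearly
    independent modulo the square of the augmentation ideal A_+, because the
    binomial coefficients C(p^k, i) vanish in K for 0 < i < p^k; so the normal
    form of a leading monomial involves no single letter, the image of d1 lies in
    A_+ P_0, and smallness is the graded Nakayama lemma.

    That the image of d1 is graded requires normal forms of homogeneous elements
    to be homogeneous, that is, the words of M to be linearly independent. They
    are products over the levels k of words a_k^i (b_k a_k)^j b_k^l with
    i, j, l < p. The level 0 factor is triangular with respect to its degree and
    then j, and modulo terms of higher level 0 degree the other factors are only
    seen through the Frobenius map, which lowers the levels by one; so
    independence follows by induction on the number of levels. *)
Require Import Defs.
From HB Require Import structures.
From mathcomp Require Import all_boot all_order all_algebra.
From mathcomp Require Import boolp classical_sets functions reals.
From mathcomp Require Import finmap complex monalg.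
From mathcomp Require Import zify ring.

Set Implicit Arguments.
Unset Strict Implicit.
Unset Printing Implicit Defensive.

Import Order.TTheory GRing.Theory Num.Theory.
Local Open Scope ring_scope.
Local Open Scope complex_scope.

(** [U] and [A] are known only through universal properties, so freeness has to be tested on a
    concrete object. For [U] this is an algebra of operators on functions of PBW exponents, in which
    a PBW monomial applied to the delta function at [(0, 0, 0)] gives the delta function at its
    exponent. Hence [U3Z] is free over the integers, integer coordinates are well defined, and the
    universal property of the scalar extension carries them to [K]; its uniqueness clause shows that
    the PBW elements span [A].

    Elements of [A] are then handled as functions on exponents, and left multiplication by a letter
    becomes an operator that evaluates its argument at smaller exponents. The digits in base [p]
    enter because each level of a word of [M] contributes three numbers below [p]: a word with [n]
    levels is encoded by an exponent with entries below [p ^ n], and dropping the lowest level is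
    division by [p]. *)

Notation exponent := (nat * nat * nat)%type.

(** * The algebra of linear operators on functions of PBW exponents *)

Section Endomorphisms.
Variable F : fieldType.
Local Notation V := (exponent -> F^o).

Definition is_endo (f : V -> V) : bool := `[< linear f >].

Lemma endo_submod : submod_closed is_endo.
Proof.
split.
  apply/asboolP => a u v; change ((0 : V) = a *: (0 : V) + 0).
  by rewrite scaler0 addr0.
move=> a f g /asboolP hf /asboolP hg; apply/asboolP => b u v.
rewrite !addrfctE !scalrfctE hf hg; apply/funext => m.
change (a * (b * f u m + f v m) + (b * g u m + g v m)
        = b * (a * f u m + g u m) + (a * f v m + g v m)).
by ring.
Qed.

HB.instance Definition _ :=
  GRing.isSubmodClosed.Build F (V -> V) is_endo endo_submod.

(** The universal property of the enveloping algebra quantifies over [algType F], so the operators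
    are packaged as a type that carries this structure. *)
Record endo : predArgType :=
  Endo { endo_fun :> V -> V; endo_funP : is_endo endo_fun }.

HB.instance Definition _ := [isSub for endo_fun].
HB.instance Definition _ := [Choice of endo by <:].
HB.instance Definition _ := [SubChoice_isSubLmodule of endo by <:].

Lemma endo_linear (f : endo) : linear f.
Proof. exact/asboolP/endo_funP. Qed.

Lemma endo_ext (f g : endo) : (forall v m, f v m = g v m) -> f = g.
Proof. by move=> h; apply/val_inj/funext => v; apply/funext => m; apply: h. Qed.

Lemma endoZ (f : endo) a v : f (a *: v) = a *: f v.
Proof.
have f0 : f 0 = 0.
  by have := endo_linear f (-1) 0 0; rewrite scaler0 addr0 scaleN1r addNr.
by have := endo_linear f a v 0; rewrite addr0 f0 addr0.
Qed.

Lemma endo_id_subproof : is_endo id.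
Proof. by apply/asboolP. Qed.

Lemma endo_comp_subproof (f g : endo) : is_endo (f \o g).
Proof. by apply/asboolP => a u v /=; rewrite !endo_linear. Qed.

Definition endo_one := Endo endo_id_subproof.
Definition endo_mul (f g : endo) := Endo (endo_comp_subproof f g).

Lemma endo_scaleE a (f : endo) v : (a *: f) v = a *: f v.
Proof. by []. Qed.

Lemma endo_mulA : associative endo_mul.
Proof. by move=> f g h; apply: endo_ext. Qed.
Lemma endo_mul1 : left_id endo_one endo_mul.
Proof. by move=> f; apply: endo_ext. Qed.
Lemma endo_mulr1 : right_id endo_one endo_mul.
Proof. by move=> f; apply: endo_ext. Qed.
Lemma endo_mulDl : left_distributive endo_mul +%R.
Proof. by move=> f g h; apply: endo_ext. Qed.
Lemma endo_mulDr : right_distributive endo_mul +%R.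
Proof.
move=> f g h; apply: endo_ext => v m.
change (f (g v + h v) m = (f (g v) + f (h v)) m).
by have := endo_linear f 1 (g v) (h v); rewrite !scale1r => ->.
Qed.
Lemma endo_one_neq0 : endo_one != 0.
Proof.
apply/eqP => /(congr1 (fun f : endo => f (fun=> 1) (0, 0, 0)%N)) /eqP.
by rewrite /= oner_eq0.
Qed.

HB.instance Definition _ := GRing.Zmodule_isNzRing.Build endo
  endo_mulA endo_mul1 endo_mulr1 endo_mulDl endo_mulDr endo_one_neq0.

Lemma endo_scaleAl (a : F) (f g : endo) : a *: (f * g) = a *: f * g.
Proof. by apply: endo_ext. Qed.

HB.instance Definition _ := GRing.Lmodule_isLalgebra.Build F endo endo_scaleAl.

Lemma endo_scaleAr (a : F) (f g : endo) : a *: (f * g) = f * (a *: g).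
Proof.
apply: endo_ext => v m; change ((a *: f (g v)) m = f (a *: g v) m).
by rewrite endoZ.
Qed.

HB.instance Definition _ := GRing.Lalgebra_isAlgebra.Build F endo endo_scaleAr.

End Endomorphisms.

(** * PBW independence in characteristic 0 *)

Section HeisenbergRepresentation.
Variable F : numFieldType.
Local Notation V := (exponent -> F^o).

(* Left multiplication by [e_alpha], [e_{alpha+beta}] and [e_beta], read on the
   coordinates in the basis of divided powers. *)
Definition opx_fun (v : V) : V :=
  fun m => m.1.1%:R * v (m.1.1.-1, m.1.2, m.2).
Definition opz_fun (v : V) : V :=
  fun m => m.1.2%:R * v (m.1.1, m.1.2.-1, m.2).
(** The second term is the commutator of [e_beta] with a divided power: [e_beta e_alpha^(i+1) =
    e_alpha^(i+1) e_beta - e_alpha^(i) e_{alpha+beta}]. Its factor arises when [e_{alpha+beta}]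
    joins [e_{alpha+beta}^(j-1)]; it is 0 where the predecessor is truncated. *)
Definition opy_fun (v : V) : V :=
  fun m => m.2%:R * v (m.1.1, m.1.2, m.2.-1)
           - m.1.2%:R * v (m.1.1.+1, m.1.2.-1, m.2).

Lemma opx_endo : is_endo opx_fun.
Proof.
apply/asboolP => a u v; apply/funext => m.
change (m.1.1%:R * (a * u (m.1.1.-1, m.1.2, m.2) + v (m.1.1.-1, m.1.2, m.2))
  = a * opx_fun u m + opx_fun v m).
by rewrite /opx_fun; ring.
Qed.

Lemma opz_endo : is_endo opz_fun.
Proof.
apply/asboolP => a u v; apply/funext => m.
change (m.1.2%:R * (a * u (m.1.1, m.1.2.-1, m.2) + v (m.1.1, m.1.2.-1, m.2))
  = a * opz_fun u m + opz_fun v m).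
by rewrite /opz_fun; ring.
Qed.

Lemma opy_endo : is_endo opy_fun.
Proof.
apply/asboolP => a u v; apply/funext => m.
change (m.2%:R * (a * u (m.1.1, m.1.2, m.2.-1) + v (m.1.1, m.1.2, m.2.-1))
  - m.1.2%:R * (a * u (m.1.1.+1, m.1.2.-1, m.2) + v (m.1.1.+1, m.1.2.-1, m.2))
  = a * opy_fun u m + opy_fun v m).
by rewrite /opy_fun; ring.
Qed.

Definition opx : endo F := Endo opx_endo.
Definition opz : endo F := Endo opz_endo.
Definition opy : endo F := Endo opy_endo.

Lemma opxy : opx * opy - opy * opx = opz.
Proof.
apply: endo_ext => v [[i j] l].
change (opx_fun (opy_fun v) (i, j, l) - opy_fun (opx_fun v) (i, j, l)
        = opz_fun v (i, j, l)).
rewrite /opx_fun /opy_fun /opz_fun /=.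
by case: i => [|i] /=; case: j => [|j] /=; rewrite ?mul0r; ring.
Qed.

Lemma opxz : opx * opz = opz * opx.
Proof.
apply: endo_ext => v [[i j] l].
change (opx_fun (opz_fun v) (i, j, l) = opz_fun (opx_fun v) (i, j, l)).
by rewrite /opx_fun /opz_fun /= mulrCA.
Qed.

Lemma opyz : opy * opz = opz * opy.
Proof.
apply: endo_ext => v [[i j] l].
change (opy_fun (opz_fun v) (i, j, l) = opz_fun (opy_fun v) (i, j, l)).
by rewrite /opy_fun /opz_fun /=; ring.
Qed.

Definition heis_rep (x : sl3p F) : endo F :=
  sl3p_mx x 0 1 *: opx + sl3p_mx x 0 2%:R *: opz + sl3p_mx x 1 2%:R *: opy.

Lemma heis_rep_linear : linear heis_rep.
Proof.
move=> a x y; rewrite /heis_rep /= !mxE !scalerDr !scalerDl !scalerA.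
by rewrite [X in X + _ = _]addrACA [LHS]addrACA.
Qed.

HB.instance Definition _ :=
  GRing.isLinear.Build F (sl3p F) (endo F) _ heis_rep heis_rep_linear.

Lemma heis_repE : [/\ heis_rep (E12 F) = opx,
  heis_rep (E13 F) = opz & heis_rep (E23 F) = opy].
Proof.
by split; rewrite /heis_rep /= !mxE /= scale1r !scale0r ?addr0 ?add0r.
Qed.

Lemma big_I3 (V : nmodType) (f : 'I_3 -> V) :
  \sum_i f i = f 0 + f 1 + f 2%:R.
Proof.
rewrite !big_ord_recl big_ord0 addr0 addrA.
by do 2?[congr (_ + _)]; congr f; apply/val_inj.
Qed.

(** The bracket of two strictly upper triangular matrices has its only entry in the corner; on the
    other side [opz] commutes with [opx] and [opy], so only a multiple of [opx * opy - opy * opx]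
    survives. *)
Lemma heis_rep_lie : is_lie_hom heis_rep.
Proof.
move=> x y; have hx := strict_upperP _ (sl3p_mxP x).
have hy := strict_upperP _ (sl3p_mxP y).
have e01 : sl3p_mx (sl3p_lie x y) 0 1 = 0.
  rewrite /= !mxE !big_I3 (hx 0 0) // (hx 1 1) // (hx 2%:R 1) // (hy 0 0) //.
  by rewrite (hy 1 1) // (hy 2%:R 1) // !(mul0r, mulr0, addr0) subrr.
have e12 : sl3p_mx (sl3p_lie x y) 1 2%:R = 0.
  rewrite /= !mxE !big_I3 (hx 1 0) // (hx 1 1) // (hx 2%:R 2%:R) // (hy 1 0) //.
  by rewrite (hy 1 1) // (hy 2%:R 2%:R) // !(mul0r, mulr0, addr0) subrr.
have e02 : sl3p_mx (sl3p_lie x y) 0 2%:R = sl3p_mx x 0 1 * sl3p_mx y 1 2%:R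
    - sl3p_mx y 0 1 * sl3p_mx x 1 2%:R.
  rewrite /= !mxE !big_I3 (hx 0 0) // (hx 2%:R 2%:R) // (hy 0 0) //.
  by rewrite (hy 2%:R 2%:R) // !(mul0r, mulr0, addr0, add0r).
rewrite {1}/heis_rep e01 e12 e02 !scale0r add0r addr0 /heis_rep.
move: (sl3p_mx x 0 1) (sl3p_mx x 0 2%:R) (sl3p_mx x 1 2%:R) => a b c.
move: (sl3p_mx y 0 1) (sl3p_mx y 0 2%:R) (sl3p_mx y 1 2%:R) => a' b' c'.
rewrite -[in LHS]opxy; apply: endo_ext => v [[i j] l].
have lin (f : endo F) (r s t : F) (u1 u2 u3 : V) :
    f (r *: u1 + s *: u2 + t *: u3) = r *: f u1 + s *: f u2 + t *: f u3.
  by rewrite -addrA endo_linear endo_linear endoZ -addrA.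
have zx : opz (opx v) = opx (opz v) by rewrite -[LHS]/((opz * opx) v) -opxz.
have zy : opz (opy v) = opy (opz v) by rewrite -[LHS]/((opz * opy) v) -opyz.
change (((a * c' - a' * c) *: (opx (opy v) - opy (opx v))) (i, j, l) =
  (a *: opx (a' *: opx v + b' *: opz v + c' *: opy v)
   + b *: opz (a' *: opx v + b' *: opz v + c' *: opy v)
   + c *: opy (a' *: opx v + b' *: opz v + c' *: opy v)
  - (a' *: opx (a *: opx v + b *: opz v + c *: opy v)
   + b' *: opz (a *: opx v + b *: opz v + c *: opy v)
   + c' *: opy (a *: opx v + b *: opz v + c *: opy v))) (i, j, l)).
rewrite !lin zx zy.
move: (opx (opx v)) (opx (opz v)) (opx (opy v)) (opz (opz v)) (opy (opx v))
  (opy (opz v)) (opy (opy v)) => f1 f2 f3 f4 f5 f6 f7.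
move: (i, j, l) => m.
change ((a * c' - a' * c) * (f3 m - f5 m) =
  a * (a' * f1 m + b' * f2 m + c' * f3 m)
  + b * (a' * f2 m + b' * f4 m + c' * f6 m)
  + c * (a' * f5 m + b' * f6 m + c' * f7 m)
  - (a' * (a * f1 m + b * f2 m + c * f3 m)
  + b' * (a * f2 m + b * f4 m + c * f6 m)
  + c' * (a * f5 m + b * f6 m + c * f7 m))).
by ring.
Qed.

Definition delta (m : exponent) : V := fun m' => (m' == m)%:R.

Lemma opx_delta i j l : opx (delta (i, j, l)) = i.+1%:R *: delta (i.+1, j, l).
Proof.
apply/funext => -[[i' j'] l'].
change (i'%:R * ((i'.-1, j', l') == (i, j, l))%:R
  = i.+1%:R * ((i', j', l') == (i.+1, j, l))%:R :> F).
rewrite !xpair_eqE; case: i' => [|i'] /=; first by rewrite mul0r mulr0.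
by rewrite eqSS; case: eqP => [->|]; rewrite //= !mulr0.
Qed.

Lemma opz_delta i j l : opz (delta (i, j, l)) = j.+1%:R *: delta (i, j.+1, l).
Proof.
apply/funext => -[[i' j'] l'].
change (j'%:R * ((i', j'.-1, l') == (i, j, l))%:R
  = j.+1%:R * ((i', j', l') == (i, j.+1, l))%:R :> F).
rewrite !xpair_eqE; case: j' => [|j'] /=; first by rewrite andbF mul0r mulr0.
by rewrite eqSS; case: (j' =P j) => [->|]; rewrite //= !andbF !mulr0.
Qed.

(** In a PBW monomial the powers of [e_beta] act first, on vectors without [e_alpha], where the
    commutator term of [opy] vanishes. *)
Lemma opy_delta l : opy (delta (0, 0, l)%N) = l.+1%:R *: delta (0, 0, l.+1)%N.
Proof.
apply/funext => -[[i' j'] l'].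
change (l'%:R * ((i', j', l'.-1) == (0, 0, l)%N)%:R
  - j'%:R * ((i'.+1, j'.-1, l') == (0, 0, l)%N)%:R
  = l.+1%:R * ((i', j', l') == (0, 0, l.+1)%N)%:R :> F).
rewrite !xpair_eqE /= mulr0 subr0.
case: l' => [|l'] /=; first by rewrite andbF mul0r mulr0.
by rewrite eqSS; case: (l' =P l) => [->|]; rewrite //= !andbF !mulr0.
Qed.

Lemma endo_divpow (f : endo F) (d : nat -> V) k :
  (forall n, f (d n) = n.+1%:R *: d n.+1) ->
  ((k`!%:R)^-1 *: f ^+ k) (d 0%N) = d k.
Proof.
move=> hd; have fk : (f ^+ k) (d 0%N) = k`!%:R *: d k.
  elim: k => [|k IH]; first by rewrite expr0 scale1r.
  rewrite exprS -[LHS]/(f ((f ^+ k) (d 0%N))) IH factS.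
  by rewrite endoZ hd scalerA mulnC natrM.
rewrite endo_scaleE fk scalerA mulVf ?scale1r //.
by rewrite pnatr_eq0 -lt0n fact_gt0.
Qed.

Variables (U : algType F) (iota : {linear sl3p F -> U}).

(** The coefficients of a linear relation between PBW monomials can be read off after applying it to
    this one vector. *)
Lemma pbw_dual_basis : is_enveloping iota ->
  exists h : {lrmorphism U -> endo F},
    forall m, h (pbw iota m) (delta (0, 0, 0)%N) = delta m.
Proof.
case=> _ /(_ _ [the {linear sl3p F -> endo F} of heis_rep] heis_rep_lie).
case=> h [hE _]; exists h => -[[i j] l]; have [rx rz ry] := heis_repE.
have hx k : h (divpow iota (E12 F) k) = (k`!%:R)^-1 *: opx ^+ k.
  rewrite /divpow linearZ /= rmorphXn /= hE; congr (_ *: _ ^+ _).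
  exact: rx.
have hz k : h (divpow iota (E13 F) k) = (k`!%:R)^-1 *: opz ^+ k.
  rewrite /divpow linearZ /= rmorphXn /= hE; congr (_ *: _ ^+ _).
  exact: rz.
have hy k : h (divpow iota (E23 F) k) = (k`!%:R)^-1 *: opy ^+ k.
  rewrite /divpow linearZ /= rmorphXn /= hE; congr (_ *: _ ^+ _).
  exact: ry.
rewrite /pbw !rmorphM /= hx hz hy.
set x := _ *: opx ^+ _; set z := _ *: opz ^+ _; set y := _ *: opy ^+ _.
rewrite -[LHS]/(x (z (y (delta (0, 0, 0)%N)))) /x /y /z.
rewrite (endo_divpow (d := fun k => delta (0, 0, k)%N)); last exact: opy_delta.
rewrite (endo_divpow (d := fun k => delta (0, k, l)%N)); last first.
  by move=> n; apply: opz_delta.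
rewrite (endo_divpow (d := fun k => delta (k, j, l)%N)) // => n.
exact: opx_delta.
Qed.

End HeisenbergRepresentation.

(** * Products of divided powers *)

Section DividedPowers.
Variables (F : numFieldType) (B : algType F).
Implicit Types x y z : B.

Definition dpow x (k : nat) : B := (k`!%:R)^-1 *: x ^+ k.

Lemma factF_neq0 k : k`!%:R != 0 :> F.
Proof. by rewrite pnatr_eq0 -lt0n fact_gt0. Qed.

Lemma dpow0 x : dpow x 0 = 1.
Proof. by rewrite /dpow expr0 invr1 scale1r. Qed.

Lemma dpowS x k : x * dpow x k = k.+1%:R *: dpow x k.+1.
Proof.
rewrite /dpow -scalerAr -exprS scalerA factS natrM invfM mulrA divff ?mul1r //.
by rewrite pnatr_eq0.
Qed.

Lemma dpowM x a b : dpow x a * dpow x b = 'C(a + b, a)%:R *: dpow x (a + b).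
Proof.
rewrite /dpow -scalerAr -scalerAl !scalerA -exprD; congr (_ *: _).
apply: (mulIf (factF_neq0 (a + b))); rewrite -[RHS]mulrA mulVf ?factF_neq0 //.
rewrite mulr1 -(bin_fact (leq_addr b a)) addKn !natrM.
by field; rewrite !factF_neq0.
Qed.

Lemma dpow_comm x y k : x * y = y * x -> dpow x k * y = y * dpow x k.
Proof.
move=> xy; rewrite /dpow -scalerAl -scalerAr; congr (_ *: _).
by apply/esym/commrX/esym.
Qed.

(** A divided power with negative exponent has to be 0, whereas truncated subtraction alone would
    give 1. *)
Definition dpow_sub x (i s : nat) : B := if (s <= i)%N then dpow x (i - s) else 0.

Variables x y z : B.
Hypothesis xyz : x * y - y * x = z.
Hypothesis xz : x * z = z * x.
Hypothesis yz : y * z = z * y.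

Lemma mul_dpow_sub i s :
  y * dpow_sub x i s = dpow_sub x i s * y - dpow_sub x i s.+1 * z.
Proof.
have yx : y * x = x * y - z by rewrite -xyz opprB addrC subrK.
have Hp k : y * x ^+ k.+1 = x ^+ k.+1 * y - (x ^+ k * z) *+ k.+1.
  elim: k => [|k IH]; first by rewrite mul1r.
  have zX : z * x ^+ k.+1 = x ^+ k.+1 * z by apply/commrX/esym.
  rewrite exprS mulrA yx mulrBl -(mulrA x y) IH mulrBr !mulrA zX -addrA -opprD.
  by rewrite mulrnAr mulrA -(exprS x k) [in RHS]mulrSr.
have H k : y * dpow x k.+1 = dpow x k.+1 * y - dpow x k * z.
  rewrite /dpow -scalerAr Hp -!scalerAl scalerBr; congr (_ - _).
  rewrite -scaler_nat scalerA factS natrM invfM mulrAC mulVf ?mul1r //.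
  by rewrite pnatr_eq0.
rewrite /dpow_sub; case: (ltngtP s i) => si; last 1 first.
- by rewrite si subnn dpow0 mulr1 mul1r mul0r subr0.
- by rewrite -(subnSK si) H.
- by rewrite mulr0 !mul0r subrr.
Qed.

(** Induction on [l] after multiplying by [l + 1], because [y] times the [l]-th divided power is
    [l + 1] times the next one. Moving the new [y] through gives two sums, the second shifted by
    one; in the term of index [s] their coefficients [l + 1 - s] and [s] add up to [l + 1]. *)
Lemma dpow_exchange l i : dpow y l * dpow x i =
  \sum_(s < l.+1) (-1) ^+ s *: (dpow_sub x i s * dpow z s * dpow y (l - s)).
Proof.
elim: l => [|l IH].
  by rewrite big_ord1 /dpow_sub !dpow0 subn0 scale1r mul1r !mulr1.
have nz : l.+1%:R != 0 :> F by rewrite pnatr_eq0.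
apply: (scalerI nz); rewrite scalerAl -dpowS -mulrA IH mulr_sumr.
pose T s r := dpow_sub x i s * dpow z s * dpow y r.
have step (s : 'I_l.+1) :
    y * ((-1) ^+ s *: (dpow_sub x i s * dpow z s * dpow y (l - s))) = (-1) ^+ s *: ((l.+1 - s)%:R *: T s (l.+1 - s)%N)
      + (-1) ^+ s.+1 *: (s.+1%:R *: T s.+1 (l.+1 - s.+1)%N).
  rewrite -scalerAr !mulrA mul_dpow_sub !mulrBl scalerBr; congr (_ + _).
    have yzs : dpow z s * y = y * dpow z s by apply: dpow_comm; rewrite yz.
    rewrite -(mulrA _ y) -yzs mulrA -(mulrA _ y) dpowS -scalerAr /T.
    by rewrite subSn // -ltnS.
  rewrite exprS mulN1r scaleNr subSS /T; congr (- (_ *: _)).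
  by rewrite -(mulrA _ z) dpowS -(scalerAr s.+1%:R) -scalerAl.
rewrite (eq_bigr _ (fun s _ => step s)) big_split /=.
rewrite scaler_sumr [RHS]big_ord_recl /=.
(* The extra term [s = l + 1] has coefficient 0; it gives both sums the same range after the
   shift. *)
have -> : \sum_(s < l.+1) (-1) ^+ s *: ((l.+1 - s)%:R *: T s (l.+1 - s)%N) =
  \sum_(s < l.+2) (-1) ^+ s *: ((l.+1 - s)%:R *: T s (l.+1 - s)%N).
  by rewrite [RHS]big_ord_recr /= subnn scale0r scaler0 addr0.
rewrite big_ord_recl /= -addrA; congr (_ + _).
  by rewrite !scalerA mulrC.
rewrite -big_split; apply: eq_bigr => s _ /=.
rewrite /bump add1n -scalerDr -scalerDl -natrD subnK; last exact: ltn_ord.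
by rewrite !scalerA mulrC.
Qed.

End DividedPowers.

(** * Integral structure constants of the PBW basis *)

Section StructureConstants.

(* [m], [m'] : exponents of the factors; [s] : the number of transpositions of
   [e_beta] past [e_alpha] that produce [e_{alpha+beta}]. *)
Definition prod_exp (m m' : exponent) (s : nat) : exponent :=
  (m.1.1 + (m'.1.1 - s), m.1.2 + m'.1.2 + s, m.2 - s + m'.2)%N.

(** The sign is that of [dpow_exchange]. Each binomial merges two divided powers of one generator;
    [e_{alpha+beta}] needs two merges, since [s] new factors join the two old powers. The guard is
    the case where [dpow_sub] vanishes. *)
Definition prod_coef (m m' : exponent) (s : nat) : int :=
  if (s <= m'.1.1)%N then
    (-1) ^+ s * ('C(m.1.1 + (m'.1.1 - s), m.1.1) * 'C(m.1.2 + m'.1.2, m.1.2)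
      * 'C(m.1.2 + m'.1.2 + s, m.1.2 + m'.1.2) * 'C(m.2 - s + m'.2, m.2 - s))%N%:Z
  else 0.

Variables (F : numFieldType) (U : algType F) (iota : {linear sl3p F -> U}).
Hypothesis env : is_enveloping iota.

Lemma sl3p_relations :
  [/\ iota (E12 F) * iota (E23 F) - iota (E23 F) * iota (E12 F) = iota (E13 F),
      iota (E12 F) * iota (E13 F) = iota (E13 F) * iota (E12 F) &
      iota (E23 F) * iota (E13 F) = iota (E13 F) * iota (E23 F)].
Proof.
have [hl _] := env.
have lieE a b c : sl3p_lie a b = c -> iota a * iota b - iota b * iota a = iota c.
  by move=> <-; rewrite -hl.
have mulE (i j k l : 'I_3) : delta_mx i j *m delta_mx k l =
   (if j == k then delta_mx i l else 0) :> 'M[F]_3.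
  by case: eqP => [->|/eqP h]; rewrite ?mul_delta_mx // mul_delta_mx_0.
split.
- by apply: lieE; apply/val_inj; rewrite /= !mulE /= subr0.
- apply/eqP; rewrite -subr_eq0; apply/eqP; rewrite -[RHS](raddf0 iota); apply: lieE.
  by apply/val_inj; rewrite /= !mulE /= subrr.
- apply/eqP; rewrite -subr_eq0; apply/eqP; rewrite -[RHS](raddf0 iota); apply: lieE.
  by apply/val_inj; rewrite /= !mulE /= subrr.
Qed.

Lemma pbw_mul m m' : pbw iota m * pbw iota m' =
  \sum_(s < m.2.+1) pbw iota (prod_exp m m' s) *~ prod_coef m m' s.
Proof.
have [xyz xz yz] := sl3p_relations.
case: m m' => [[i j] l] [[i' j'] l'].
rewrite /pbw /prod_exp /prod_coef /=.
rewrite -![divpow _ _ _]/(dpow (iota _) _).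
under eq_bigr do rewrite -![divpow _ _ _]/(dpow (iota _) _).
move: (iota (E12 F)) (iota (E13 F)) (iota (E23 F)) xyz xz yz => x z y xyz xz yz.
have zx k k' : dpow z k * dpow x k' = dpow x k' * dpow z k.
  by apply: dpow_comm; rewrite dpow_comm.
have zy k k' : dpow z k * dpow y k' = dpow y k' * dpow z k.
  by apply: dpow_comm; rewrite dpow_comm.
have zz k k' : dpow z k * dpow z k' = dpow z k' * dpow z k.
  by apply: dpow_comm; rewrite dpow_comm.
have -> : dpow x i * dpow z j * dpow y l * (dpow x i' * dpow z j' * dpow y l')
    = dpow x i * dpow z j * (dpow y l * dpow x i') * (dpow z j' * dpow y l').
  by rewrite !mulrA.
rewrite (dpow_exchange xyz xz yz) mulr_sumr mulr_suml; apply: eq_bigr => s _.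
rewrite -scalerAr -scalerAl /dpow_sub; case: ifP => si; last first.
  by rewrite !mul0r mulr0 mul0r scaler0.
set X := dpow x (i' - s); set Z := dpow z s; set Y := dpow y (l - s).
have -> : dpow x i * dpow z j * (X * Z * Y) * (dpow z j' * dpow y l')
    = (dpow x i * X) * ((dpow z j * dpow z j') * Z) * (Y * dpow y l').
  rewrite !mulrA -(mulrA _ (dpow z j) X) zx !mulrA.
  rewrite -(mulrA _ Y (dpow z j')) -zy !mulrA.
  by rewrite -(mulrA _ Z (dpow z j')) zz !mulrA.
have sc (a b c : F) (u v w : U) :
    (a *: u) * (b *: v) * (c *: w) = (a * b * c) *: (u * v * w).
  by rewrite -!scalerAl -!scalerAr -!scalerAl !scalerA; congr (_ *: _); ring.
have -> : dpow z j * dpow z j' * Z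
    = ('C(j + j', j)%:R * 'C(j + j' + s, j + j')%:R) *: dpow z (j + j' + s).
  by rewrite dpowM -(scalerAl 'C(_, _)%:R) dpowM scalerA.
rewrite /X /Y !dpowM sc scalerA.
rewrite -scaler_int; congr (_ *: _).
rewrite intrM rmorphXn /= rmorphN1 -!mulrA; congr (_ * _).
by rewrite -pmulrn !natrM; ring.
Qed.

End StructureConstants.

(** * Additive extension of maps from a basis *)

Section MalgSums.
Variables (T : choiceType) (G V : zmodType) (h : T -> G -> V).
Hypothesis hD : forall k, {morph h k : x y / x + y}.

(** The sums over supports in [U3Z], [poly_val], [d0] and [d1] all have this form. Supports can
    shrink under addition, so additivity is proved over a common larger index set, once for all of
    them. *)
Definition malg_sum (f : {malg G[T]}) : V := \sum_(k <- msupp f) h k f@_k.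

Lemma malg_sum_coef0 k : h k 0 = 0.
Proof. by apply: (addrI (h k 0)); rewrite -hD !addr0. Qed.

Lemma malg_sumEw (d : {fset T}) f :
  (msupp f `<=` d)%fset -> malg_sum f = \sum_(k <- d) h k f@_k.
Proof.
move=> fd; rewrite /malg_sum; apply/big_fset_incl => // k _ /mcoeff_outdom ->.
exact: malg_sum_coef0.
Qed.

Lemma malg_sumD f g : malg_sum (f + g) = malg_sum f + malg_sum g.
Proof.
rewrite (malg_sumEw (msuppD_le f g)) (malg_sumEw (fsubsetUl _ (msupp g))).
rewrite (malg_sumEw (fsubsetUr (msupp f) _)) -big_split.
by apply: eq_bigr => k _; rewrite mcoeffD hD.
Qed.

Lemma malg_sum0 : malg_sum 0 = 0.
Proof. by rewrite /malg_sum msupp0 big_seq_fset0. Qed.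

Lemma malg_sumB f g : malg_sum (f - g) = malg_sum f - malg_sum g.
Proof. by apply: (addIr (malg_sum g)); rewrite -malg_sumD !subrK. Qed.

Lemma malg_sumU c k : malg_sum << c *g k >> = h k c.
Proof. by rewrite (malg_sumEw msuppU_le) big_seq_fset1 mcoeffUU. Qed.

Lemma malg_sum_sum (I : Type) (r : seq I) (P : pred I) (F : I -> {malg G[T]}) :
  malg_sum (\sum_(i <- r | P i) F i) = \sum_(i <- r | P i) malg_sum (F i).
Proof. exact: (big_morph malg_sum malg_sumD malg_sum0). Qed.

End MalgSums.

(** * PBW coordinates on the scalar extension *)

Section Coordinates.
Variables (F : numFieldType) (U : algType F) (iota : {linear sl3p F -> U}).
Variables (K : fieldType) (A : algType K) (phi : U -> A).
Hypothesis env : is_enveloping iota.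
Hypothesis ext : is_scalar_extension iota phi.

Local Notation U3 := (U3Z iota).

Lemma pbw_mulzD m : {morph (fun c => pbw iota m *~ c) : x y / x + y}.
Proof. by move=> a b; rewrite mulrzDr. Qed.

Local Notation pbw_sum := (malg_sum (fun m c => pbw iota m *~ c)).

Lemma U3Z0 : U3 0.
Proof. by exists 0; rewrite msupp0 big_seq_fset0. Qed.

Lemma U3Z_pbw m c : U3 (pbw iota m *~ c).
Proof. by exists << c *g m >>; rewrite -[RHS]/(pbw_sum _) (malg_sumU pbw_mulzD). Qed.

Lemma U3ZD u v : U3 u -> U3 v -> U3 (u + v).
Proof.
move=> [f ->] [g ->]; exists (f + g).
by rewrite -![RHS]/(pbw_sum _) malg_sumD //; exact: pbw_mulzD.
Qed.

Lemma phi0 : phi 0 = 0.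
Proof.
have := phiD ext U3Z0 U3Z0; rewrite addr0 -[X in X = _]addr0.
by move/addrI/esym.
Qed.

Lemma phi_pbwz m c : phi (pbw iota m *~ c) = phi (pbw iota m) *~ c.
Proof.
have hD a b : phi (pbw iota m *~ (a + b))
      = phi (pbw iota m *~ a) + phi (pbw iota m *~ b).
  by rewrite mulrzDr (phiD ext) //; exact: U3Z_pbw.
elim/int_ind: c => [|n IH|n IH]; first by rewrite !mulr0z phi0.
  by rewrite -addn1 PoszD hD IH mulrzDr mulr1z.
apply: (addIr (phi (pbw iota m *~ 1))); rewrite -hD.
by rewrite -addn1 PoszD opprD -addrA addNr addr0 IH mulrzDr mulrNz !mulr1z subrK.
Qed.

(** [phi] is additive only on [U3Z], so the membership of the partial sums is carried through the
    induction. *)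
Lemma phi_sum (I : Type) (r : seq I) (e : I -> exponent) (c : I -> int) :
  U3 (\sum_(i <- r) pbw iota (e i) *~ c i) /\
  phi (\sum_(i <- r) pbw iota (e i) *~ c i)
    = \sum_(i <- r) phi (pbw iota (e i)) *~ c i.
Proof.
elim: r => [|i r [IH1 IH2]]; first by rewrite !big_nil phi0; split=> //; exact: U3Z0.
rewrite !big_cons; have hi := U3Z_pbw (e i) (c i).
by split; [exact: U3ZD | rewrite (phiD ext) // phi_pbwz IH2].
Qed.

(** Applied to the delta function at [(0, 0, 0)] and evaluated at [m], a relation leaves its
    coefficient at [m] as an integer in [F], and integers embed in [F]. *)
Lemma pbw_sum_inj : injective pbw_sum.
Proof.
have [h hE] := pbw_dual_basis env.
move=> f g /eqP; rewrite -subr_eq0 -(malg_sumB pbw_mulzD) => /eqP E.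
apply/eqP; rewrite -subr_eq0; apply/eqP/malgP => m; rewrite mcoeff0.
move: (f - g) E => {f g}f; rewrite /malg_sum => /(congr1 h); rewrite raddf_sum raddf0.
move=> /(congr1 (fun v : endo F => v (delta F (0, 0, 0)%N) m)).
have app I (r : seq I) (G : I -> endo F) v :
    (\sum_(i <- r) G i) v m = \sum_(i <- r) G i v m.
  by elim/big_rec2: _ => //= i y x _ <-.
rewrite app => E.
have appz (e : endo F) v (c : int) : (e *~ c) v m = e v m *~ c.
  by rewrite -!scaler_int.
case: (msuppP f m) => [mf|//]; move: E.
rewrite (big_fsetD1 m) //= raddfMz appz hE /delta eqxx.
rewrite big1_fset => [|m']; last first.
  rewrite in_fsetD1 => /andP[mm' _] _; rewrite raddfMz appz hE /delta.
  by rewrite eq_sym (negbTE mm') mul0rz.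
by rewrite addr0 => /eqP; rewrite -[_ == _]/((_ *~ _) == 0) intr_eq0 => /eqP.
Qed.

(** Defined on all of [U], as [phi_universal] requires of its argument; the value off [U3Z] is 0. *)
Definition int_coord (u : U) : {malg int[exponent]} :=
  xget 0 [set f | u = pbw_sum f].

Lemma int_coordK f : int_coord (pbw_sum f) = f.
Proof.
rewrite /int_coord; case: xgetP => [g _ /= /pbw_sum_inj//|/(_ f)].
by move=> /(_ erefl).
Qed.

(** The map [g] is obtained from the universal property applied to the integer coordinates mapped to
    [K]. Spanning comes from uniqueness: the composite of [g] with the map back to [A] and the
    identity of [A] both extend [phi]. *)
Lemma coordinates : exists g : {linear A -> {malg K[exponent]}},
  (forall m, g (phi (pbw iota m)) = << m >>) /\
  forall a, a = \sum_(m <- msupp (g a)) (g a)@_m *: phi (pbw iota m).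
Proof.
pose red (f : {malg int[exponent]}) : {malg K[exponent]} :=
  malg_sum (fun m (c : int) => << c%:~R *g m >>) f.
have redD f g : red (f + g) = red f + red g.
  by apply: malg_sumD => m a b; rewrite -monalgUD rmorphD.
have [|g [gE _]] := phi_universal ext (f := fun u => red (int_coord u)).
  move=> u v [f ->] [f' ->]; rewrite -![\sum_(_ <- _) _]/(pbw_sum _).
  by rewrite -(malg_sumD pbw_mulzD) !int_coordK redD.
have pbwE m : pbw iota m = pbw_sum << 1 *g m >>.
  by rewrite malg_sumU ?mulr1z //; exact: pbw_mulzD.
have gpbw m : g (phi (pbw iota m)) = << m >>.
  rewrite gE; last by rewrite -[pbw _ _]mulr1z; exact: U3Z_pbw.
  rewrite pbwE int_coordK /red malg_sumU // => k a b.
  by rewrite -monalgUD rmorphD.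
pose back (v : {malg K[exponent]}) : A :=
  malg_sum (fun m c => c *: phi (pbw iota m)) v.
have hback m : {morph (fun c => c *: phi (pbw iota m)) : x y / x + y}.
  by move=> a b; rewrite scalerDl.
have backL : linear (back \o g).
  move=> c u v /=; rewrite linearP /back malg_sumD //; congr (_ + _).
  rewrite (malg_sumEw hback (msuppZ_le c (g u))) /malg_sum scaler_sumr.
  by apply: eq_bigr => m _; rewrite mcoeffZ scalerA.
pose bg : {linear A -> A} :=
  HB.pack (back \o g) (GRing.isLinear.Build _ _ _ _ _ backL).
have phiL u : U3 u -> bg (phi u) = phi u.
  move=> U3u; rewrite /bg /= gE //; case: U3u => f ->.
  rewrite -[\sum_(_ <- _) _]/(pbw_sum f) int_coordK.
  rewrite /red /back [X in malg_sum _ X]/malg_sum malg_sum_sum //.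
  rewrite [X in _ = phi X]/malg_sum (phi_sum _ id _).2.
  apply: eq_bigr => m _; rewrite malg_sumU //.
  by rewrite scaler_int.
have [g0 [_ g0u]] := phi_universal ext (f := phi) (phiD ext).
have bgE : bg =1 idfun.
  by move=> a; rewrite (g0u bg) // (g0u [the {linear A -> A} of idfun]).
exists g; split=> // a; rewrite -{1}[a]/(idfun a) -bgE; exact: erefl.
Qed.

Lemma phi_pbw_mul m m' : phi (pbw iota m) * phi (pbw iota m') =
  \sum_(s < m.2.+1) (prod_coef m m' s)%:~R *: phi (pbw iota (prod_exp m m' s)).
Proof.
have Up k : U3 (pbw iota k) by rewrite -[pbw _ _]mulr1z; exact: U3Z_pbw.
rewrite -(phiM ext) // (pbw_mul env).
rewrite (phi_sum _ (fun s : 'I_m.2.+1 => prod_exp m m' s) _).2.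
by apply: eq_bigr => s _; rewrite scaler_int.
Qed.

Lemma phi_pbw0 : phi (pbw iota (0, 0, 0)%N) = 1.
Proof.
rewrite /pbw /= -![divpow _ _ _]/(dpow (iota _) _) !dpow0 !mulr1.
exact: phi1 ext.
Qed.

End Coordinates.

(** * Independence of the normal words *)

Section CoordinateOperators.
Variables (K : fieldType) (p : nat).
Hypothesis pK : p \in [pchar K].
Implicit Types (v : exponent -> K) (m : exponent).

(* Left multiplication by [e_alpha^(q)] and by [e_beta^(q)], read on the
   coordinates in the PBW basis. *)
Definition xop (q : nat) v : exponent -> K :=
  fun m => 'C(m.1.1, q)%:R * v (m.1.1 - q, m.1.2, m.2)%N.

(** The index [s] is that of [dpow_exchange]: [s] factors [e_beta] turn into [e_{alpha+beta}] and
    [q - s] join the power of [e_beta]; the binomials come from the merged divided powers. *)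
Definition yop (q : nat) v : exponent -> K :=
  fun m => \sum_(s < q.+1) (-1) ^+ s * ('C(m.1.2, s) * 'C(m.2, q - s))%:R
                           * v (m.1.1 + s, m.1.2 - s, m.2 - (q - s))%N.

Definition letter_op (x : letter) v : exponent -> K :=
  if x.1 then yop (p ^ x.2) v else xop (p ^ x.2) v.

Definition coord1 : exponent -> K := fun m => (m == (0, 0, 0)%N)%:R.

(** The coordinate vector of the value of a word in [A], built from that of 1; see [coef_word]. *)
Definition word_op (s : seq letter) : exponent -> K := foldr letter_op coord1 s.

Let pp : prime p. Proof. exact: pcharf_prime pK. Qed.
Let p_gt0 : (0 < p)%N. Proof. exact: prime_gt0. Qed.

Lemma natr_mulp a b : (p * a + b)%:R = b%:R :> K.
Proof. by rewrite natrD natrM (pcharf0 pK) mul0r add0r. Qed.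

(** This is [(1 + X)^(p a) = (1 + X^p)^a] in characteristic [p]. In the Vandermonde sum for
    [p + p a] only the indices 0 and [p] survive. *)
Lemma bin_mulp a b :
  'C(p * a, b)%:R = (if (p %| b)%N then 'C(a, b %/ p)%:R else 0) :> K.
Proof.
elim: a b => [|a IH] b.
  rewrite muln0 !bin0n; case: (posnP b) => [->|b0]; first by rewrite dvdn0 div0n.
  case: ifP => // pb.
  have : (0 < b %/ p)%N by rewrite divn_gt0 // dvdn_leq.
  by case: (b %/ p)%N.
rewrite mulnS -binomial.Vandermonde natr_sum.
have C0 (i : nat) : (0 < i < p)%N -> 'C(p, i)%:R = 0 :> K.
  by move=> hi; apply/eqP; rewrite -(dvdn_pcharf pK) prime_dvd_bin.
case: (ltnP b p) => bp.
  rewrite big_ord_recl bin0 mul1n subn0 big1 => [|i _]; last first.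
    by rewrite natrM C0 ?mul0r // lift0 /= (leq_ltn_trans (ltn_ord i)).
  rewrite addr0 IH; case: ifP => // pb; rewrite divn_small //.
  by rewrite !bin0.
rewrite (bigD1 (inord 0)) //= inordK // bin0 mul1n subn0.
rewrite (bigD1 (inord p)) /=; last first.
  by rewrite -val_eqE /= !inordK // -lt0n.
rewrite inordK // binn mul1n big1 => [|i /andP[i0 ip]]; last first.
  rewrite -val_eqE /= inordK // in i0; rewrite -val_eqE /= inordK // in ip.
  case: (ltngtP i p) ip => // ip _; last by rewrite bin_small // mul0n.
  by rewrite natrM C0 ?mul0r // lt0n i0.
rewrite addr0 !IH (dvdn_subl bp (dvdnn p)); case: ifP => pb; last by rewrite addr0.
have -> : (b %/ p)%N = ((b - p) %/ p).+1.
  by rewrite -{1}(subnK bp) divnDr // divnn p_gt0 addn1.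
by rewrite -natrD -binS.
Qed.

Definition scalep m : exponent := (p * m.1.1, p * m.1.2, p * m.2)%N.

(** Composition with [scalep] is the Frobenius map of the overview read on coordinates: it turns
    letters of level [k + 1] into letters of level [k]. *)
Lemma xop_scalep q v m : xop (p * q) v (scalep m) = xop q (v \o scalep) m.
Proof. by rewrite /xop /= bin_mulp dvdn_mulr // mulKn // -mulnBr. Qed.

Lemma yop_scalep q v m : yop (p * q) v (scalep m) = yop q (v \o scalep) m.
Proof.
rewrite /yop /=.
pose f s : K := (-1) ^+ s * ('C(p * m.1.2, s) * 'C(p * m.2, p * q - s))%:R
  * v (p * m.1.1 + s, p * m.1.2 - s, p * m.2 - (p * q - s))%N.
have f0 s : ~~ (p %| s)%N -> f s = 0.
  by move=> /negbTE ps; rewrite /f natrM bin_mulp ps mul0r mulr0 mul0r.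
have sum_f n : \sum_(s < (p * n).+1) f s = \sum_(s < n.+1) f (p * s)%N.
  elim: n => [|n IH]; first by rewrite muln0 !big_ord1 muln0.
  rewrite [RHS]big_ord_recr -IH /= -!(big_mkord predT).
  rewrite (big_cat_nat (n := (p * n).+1)) //=; last first.
    by rewrite ltnS leq_mul2l leqnSn orbT.
  congr (_ + _); rewrite big_nat_recr; last by rewrite ltn_pmul2l.
  rewrite big_nat big1 /= ?add0r // => s /andP[ns sn]; apply: f0.
  apply/negP => /dvdnP[t st]; move: ns sn; rewrite st (mulnC t) !ltn_pmul2l //.
  by rewrite ltnS => h1 h2; have := leq_ltn_trans h2 h1; rewrite ltnn.
rewrite sum_f; apply: eq_bigr => s _; rewrite /f -mulnBr natrM !bin_mulp.
rewrite !dvdn_mulr // !mulKn // -natrM /scalep /= mulnDr !mulnBr.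
congr (_ * _ * _); rewrite exprM; congr (_ ^+ _).
(* [(-1) ^+ p = -1] in [K]: either [p] is odd, or [p = 2] and [-1 = 1]. *)
have [p2|p1] := even_prime pp; last by rewrite -signr_odd p1 expr1.
have pK2 : 2%N \in [pchar K] by rewrite -p2.
by rewrite (oppr_pchar2 pK2) expr1n.
Qed.

(** * The last base-[p] digits and the filtration by their weight *)

Local Notation xop1 := (xop 1).
Local Notation yop1 := (yop 1).

Lemma xop1E v m : xop1 v m = m.1.1%:R * v (m.1.1.-1, m.1.2, m.2).
Proof. by rewrite /xop bin1 subn1. Qed.

Lemma yop1E v m : yop1 v m = m.2%:R * v (m.1.1, m.1.2, m.2.-1)
                              - m.1.2%:R * v (m.1.1.+1, m.1.2.-1, m.2).
Proof.
rewrite /yop !big_ord_recl big_ord0 /= !bin0 subn0 bin1 mul1n muln1 bin1.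
by rewrite addn0 !subn0 !subn1 expr0 mul1r addn1 addr0 expr1 mulN1r mulNr.
Qed.

Definition with_digits m d : exponent :=
  (p * m.1.1 + d.1.1, p * m.1.2 + d.1.2, p * m.2 + d.2)%N.

Definition is_digits (d : exponent) := [&& d.1.1 < p, d.1.2 < p & d.2 < p]%N.

(* The weight of the last digits: left multiplication by [e_alpha] or [e_beta]
   raises it by at least 1. *)
Definition weight (d : exponent) := (d.1.1 + d.1.2.*2 + d.2)%N.

Definition vanish_below n v := forall m d, is_digits d -> (weight d < n)%N ->
  v (with_digits m d) = 0.

Lemma xop1_digits v m a b c : xop1 v (with_digits m (a, b, c)) =
  if a is a'.+1 then a%:R * v (with_digits m (a', b, c)) else 0.
Proof.
rewrite xop1E /with_digits /= natr_mulp.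
by case: a => [|a]; rewrite ?mul0r // addnS.
Qed.

(** The case [a.+1 == p] is a carry into the next digit. It evaluates [v] at digits of even smaller
    weight, so it respects the filtration. *)
Lemma yop1_digits v m a b c : (a < p)%N ->
  yop1 v (with_digits m (a, b, c)) =
  (if c is c'.+1 then c%:R * v (with_digits m (a, b, c')) else 0) -
  (if b is b'.+1 then b%:R * v (if a.+1 == p
     then with_digits (m.1.1.+1, m.1.2, m.2) (0, b', c)%N
     else with_digits m (a.+1, b', c)) else 0).
Proof.
move=> ap; rewrite yop1E /with_digits /= !natr_mulp.
congr (_ - _); first by case: c => [|c]; rewrite ?mul0r // addnS.
case: b => [|b]; rewrite ?mul0r // addnS /=; congr (_ * v _).
case: eqP => e; last by rewrite addnS.
by rewrite -addnS e mulnS !addn0 (addnC p).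
Qed.

Lemma vanish_xop1 n v : vanish_below n v -> vanish_below n.+1 (xop1 v).
Proof.
move=> hv m [[a b] c] /and3P[/= ap bp cp]; rewrite xop1_digits /weight /= => w.
case: a ap w => [//|a] ap w; rewrite hv ?mulr0 //.
by rewrite /is_digits /= bp cp (ltnW ap).
Qed.

Lemma vanish_yop1 n v : vanish_below n v -> vanish_below n.+1 (yop1 v).
Proof.
move=> hv m [[a b] c] /and3P[/= ap bp cp] w; rewrite yop1_digits // /weight /= in w *.
have -> : (if c is c'.+1 then c%:R * v (with_digits m (a, b, c')) else 0) = 0.
  case: c cp w => [//|c] cp w; rewrite hv ?mulr0 // /is_digits /weight /=.
    by rewrite ap bp (ltnW cp).
  lia.
case: b bp w => [|b] bp w; rewrite sub0r ?oppr0 //.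
case: eqP => ap'; rewrite hv ?mulr0 ?oppr0 // /is_digits /weight /=
  ?cp ?(ltnW bp) ?andbT //; lia.
Qed.

Definition bxop1 v := yop1 (xop1 v).

Lemma vanish_iter (op : (exponent -> K) -> exponent -> K) k :
  (forall n v, vanish_below n v -> vanish_below (n + k) (op v)) ->
  forall a n v, vanish_below n v -> vanish_below (n + a * k) (iter a op v).
Proof.
move=> hop; elim=> [|a IH] n v hv; first by rewrite addn0.
by rewrite mulSn [(k + _)%N]addnC addnA; apply: hop; exact: IH.
Qed.

Definition block_op (d : exponent) v :=
  iter d.1.1 xop1 (iter d.1.2 bxop1 (iter d.2 yop1 v)).

Lemma vanish_block d v : vanish_below (weight d) (block_op d v).
Proof.
have -> : weight d = (0 + d.2 * 1 + d.1.2 * 2 + d.1.1 * 1)%N by rewrite /weight; lia.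
apply: vanish_iter => [n w /vanish_xop1|]; first by rewrite addn1.
apply: vanish_iter => [n w /vanish_xop1/vanish_yop1|]; first by rewrite addn2.
by apply: vanish_iter => [n w /vanish_yop1|]; first by rewrite addn1.
Qed.

(** Each [yop1] uses up at least one unit of weight. With at most [n] units for [n] steps, every
    step must cost exactly one and end at weight 0; a step that lowers the middle digit either
    leaves a positive first digit, which only a carry could remove, or is a carry and costs more. *)
Lemma iter_yop1_eq0 n v m d : is_digits d -> (weight d <= n)%N ->
  d != (0, 0, n)%N -> iter n yop1 v (with_digits m d) = 0.
Proof.
elim: n m d => [|n IH] m [[a b] c] /and3P[/= ap bp cp];
  rewrite /weight /= !xpair_eqE => w ne.
  by move: w ne; lia.
rewrite yop1_digits //.
have -> : (if c is c'.+1 then c%:R * iter n yop1 v (with_digits m (a, b, c')) else 0) = 0.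
  case: c cp w ne => [//|c] cp w ne; rewrite IH ?mulr0 //.
  - by rewrite /is_digits /= ap bp (ltnW cp).
  - by rewrite /weight /=; lia.
case: b bp w ne => [|b] bp w ne; rewrite sub0r ?oppr0 //.
case: eqP => ap'; rewrite IH ?mulr0 ?oppr0 // /is_digits /weight ?xpair_eqE /=
  ?cp ?(ltnW bp) ?andbT //; lia.
Qed.

Lemma iter_yop1 n v m : iter n yop1 v (with_digits m (0, 0, n)%N) =
  n`!%:R * v (scalep m).
Proof.
elim: n => [|n IH]; first by rewrite /with_digits !addn0 mul1r.
by rewrite /= yop1_digits //= IH subr0 mulrA factS natrM.
Qed.

(** Each [bxop1] lowers either the middle digit or both outer digits by one. Reaching the middle
    digit 0 from at least [b0] in [b0] steps rules out the second kind, so the outer digits are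
    untouched and [iter_yop1_eq0] forces them to be [0] and [n]. *)
Lemma iter_bxop1_eq0 b0 n v m d : is_digits d ->
  (weight d <= b0.*2 + n)%N -> (b0 <= d.1.2)%N -> d != (0, b0, n)%N ->
  iter b0 bxop1 (iter n yop1 v) (with_digits m d) = 0.
Proof.
elim: b0 m d => [|b0 IH] m [[a b] c] hd w bb ne; first exact: iter_yop1_eq0.
move: hd w bb ne => /and3P[/= ap bp cp]; rewrite /weight !xpair_eqE /= => w bb ne.
rewrite -[LHS]/(yop1 (xop1 (iter b0 bxop1 (iter n yop1 v))) _) yop1_digits //.
move: IH; set w0 := iter b0 _ _ => IH.
have -> : (if c is c'.+1 then c%:R * xop1 w0 (with_digits m (a, b, c')) else 0) = 0.
  case: c cp w ne => [//|c] cp w ne; rewrite xop1_digits.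
  case: a ap w ne => [|a] ap w ne; rewrite ?mulr0 // IH ?mulr0 //.
  - by rewrite /is_digits /= bp (ltnW cp) (ltnW ap).
  - by rewrite /weight /=; lia.
  - exact: ltnW.
  - by rewrite !xpair_eqE /=; lia.
case: b bp w bb ne => [|b] bp w bb ne; rewrite sub0r ?oppr0 //.
(* After a carry the first digit is 0, where [xop1] gives 0. *)
case: eqP => ap'; rewrite xop1_digits ?mulr0 ?oppr0 //.
rewrite IH ?mulr0 ?oppr0 //.
- by rewrite /is_digits /= ap cp (ltnW bp).
- by rewrite /weight /=; lia.
Qed.

Lemma iter_bxop1 b0 n v m :
  iter b0 bxop1 (iter n yop1 v) (with_digits m (0, b0, n)%N) =
  (-1) ^+ b0 * (b0`! * n`!)%:R * v (scalep m).
Proof.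
elim: b0 => [|b0 IH]; first by rewrite -[LHS]/(iter n yop1 v _) iter_yop1 mul1r mul1n.
rewrite -[LHS]/(yop1 (xop1 (iter b0 bxop1 (iter n yop1 v))) _) yop1_digits //.
move: IH.
set w0 := iter b0 _ _ => IH.
have -> : (if n is c'.+1 then n%:R * xop1 w0 (with_digits m (0, b0.+1, c')%N) else 0) = 0.
  by case: (n) => [//|c]; rewrite xop1_digits mulr0.
rewrite ltn_eqF ?prime_gt1 // sub0r xop1_digits mul1r IH factS !natrM exprS; ring.
Qed.
(** Weight alone does not separate the blocks: [(b a)^j] also has a component at [a^j b^j], of the
    same weight but with smaller middle digit. Hence the second condition on the digits. *)
Lemma block_op_eq0 d0 v m d : is_digits d -> (weight d <= weight d0)%N ->
  (d0.1.2 <= d.1.2)%N -> d != d0 -> block_op d0 v (with_digits m d) = 0.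
Proof.
case: d0 => [[a0 b0] c0]; rewrite /block_op /=.
elim: a0 m d => [|a0 IH] m [[a b] c] hd w bb ne.
  by apply: iter_bxop1_eq0 => //; move: w; rewrite /weight /=; lia.
rewrite iterS xop1_digits.
case: a hd w bb ne => [//|a] /and3P[/= ap bp cp]; rewrite /weight /= => w bb ne.
by rewrite IH ?mulr0 // /is_digits /= bp cp (ltnW ap).
Qed.

Lemma block_op_diag d v m : block_op d v (with_digits m d) =
  (-1) ^+ d.1.2 * (d.1.1`! * d.1.2`! * d.2`!)%:R * v (scalep m).
Proof.
case: d => [[a b] c]; rewrite /block_op /=.
elim: a => [|a IH].
  by rewrite -[LHS]/(iter b bxop1 (iter c yop1 v) _) iter_bxop1 mul1n.
by rewrite iterS xop1_digits IH factS !natrM; ring.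
Qed.

Lemma block_op_diag_neq0 d : is_digits d ->
  (-1) ^+ d.1.2 * (d.1.1`! * d.1.2`! * d.2`!)%:R != 0 :> K.
Proof.
have f0 n : (n < p)%N -> n`!%:R != 0 :> K.
  move=> np; rewrite -(dvdn_pcharf pK); elim: n np => [|n IH] np.
    by rewrite dvdn1; move: (prime_gt1 pp); case: (p) => [|[]].
  rewrite factS Euclid_dvdM // negb_or IH ?(ltnW np) // andbT.
  by apply/negP => /(dvdn_leq (ltn0Sn n)); rewrite leqNgt np.
case/and3P => ? ? ?; rewrite mulf_neq0 ?signr_eq0 // !natrM.
by rewrite !mulf_neq0 ?f0.
Qed.

(** * Normal words and their independence *)

Definition quo m : exponent := (m.1.1 %/ p, m.1.2 %/ p, m.2 %/ p)%N.
Definition rem m : exponent := (m.1.1 %% p, m.1.2 %% p, m.2 %% p)%N.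

Lemma with_digitsK m : with_digits (quo m) (rem m) = m.
Proof.
case: m => [[i j] l]; rewrite /with_digits /quo /rem /=.
by rewrite ![(p * _)%N]mulnC -!divn_eq.
Qed.

Lemma is_digits_rem m : is_digits (rem m).
Proof. by rewrite /is_digits /rem /= !ltn_mod p_gt0. Qed.

(* The words [prod_k a_k^(i_k) (b_k a_k)^(j_k) b_k^(l_k)], where [i_k], [j_k],
   [l_k] are the base-[p] digits of [m]; those containing no leading monomial
   of the Groebner basis have this form. *)
Fixpoint normal_word n k m : seq letter :=
  if n is n'.+1 then
    nseq (m.1.1 %% p) (false, k)
    ++ flatten (nseq (m.1.2 %% p) [:: (true, k); (false, k)])
    ++ nseq (m.2 %% p) (true, k) ++ normal_word n' k.+1 (quo m)
  else [::].

Lemma normal_wordS n k m : normal_word n k.+1 m =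
  [seq (x.1, x.2.+1) | x <- normal_word n k m].
Proof.
elim: n k m => [//|n IH] k m /=; rewrite !map_cat !map_nseq IH map_flatten.
by rewrite map_nseq.
Qed.

Lemma word_op_shift s m :
  word_op [seq (x.1, x.2.+1) | x <- s] (scalep m) = word_op s m.
Proof.
elim: s m => [|[b k] s IH] m.
  rewrite /= /coord1 /scalep; case: m => [[i j] l] /=; rewrite !xpair_eqE.
  by rewrite !muln_eq0 !(gtn_eqF p_gt0).
have E : word_op [seq (x.1, x.2.+1) | x <- s] \o scalep = word_op s.
  by apply/funext => m' /=.
by rewrite /= /letter_op /=; case: b => /=; rewrite expnS ?xop_scalep ?yop_scalep E.
Qed.

Lemma word_op_normal n m : word_op (normal_word n.+1 0 m) =
  block_op (rem m) (word_op (normal_word n 1 (quo m))).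
Proof.
have op_nseq a x s : word_op (nseq a x ++ s) = iter a (letter_op x) (word_op s).
  by elim: a => //= a ->.
rewrite /= op_nseq /block_op /=; congr (iter _ _ _).
transitivity (iter (m.1.2 %% p) bxop1 (word_op (nseq (m.2 %% p) (true, 0%N)
   ++ normal_word n 1 (quo m)))); last by rewrite op_nseq.
by elim: (m.1.2 %% p)%N => //= a ->.
Qed.

Lemma normal_words_free n (r : seq exponent) (c : exponent -> K) : uniq r ->
  (forall m, m \in r -> [&& m.1.1 < p ^ n, m.1.2 < p ^ n & m.2 < p ^ n]%N) ->
  (forall m, \sum_(m' <- r) c m' * word_op (normal_word n 0 m') m = 0) ->
  forall m, m \in r -> c m = 0.
Proof.
elim: n r c => [|n IH] r c ur rn sum0 m mr.
  have r0 m' : m' \in r -> m' = (0, 0, 0)%N.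
    by move=> /rn; case: m' => [[[|?] [|?]] [|?]].
  have := sum0 (0, 0, 0)%N; rewrite (bigD1_seq m) //= big1_seq => [|m' /andP[]].
    by rewrite /coord1 eqxx mulr1 addr0.
  by move=> mm /r0 m'0; rewrite m'0 (r0 _ mr) eqxx in mm.
(* Orders the last digits by weight and, at equal weight, by decreasing middle digit. The order is
   lexicographic since the second summand lies between 1 and [p]. *)
pose mu m := (weight (rem m) * p + (p - (rem m).1.2))%N.
have [N] := ubnP (mu m); elim: N m mr => // N IHN m mr; rewrite ltnS => muN.
have IHm m1 : m1 \in r -> (mu m1 < mu m)%N -> c m1 = 0.
  by move=> m1r lt; apply: IHN => //; apply: leq_trans lt muN.
pose r' := [seq quo m1 | m1 <- r & rem m1 == rem m].
pose c' q := c (with_digits q (rem m)).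
have c'E m1 : rem m1 == rem m -> c' (quo m1) = c m1.
  by rewrite /c' => /eqP <-; rewrite with_digitsK.
rewrite -(c'E m) //; apply: (IH r').
- rewrite map_inj_in_uniq ?filter_uniq // => m1 m2.
  rewrite !mem_filter => /andP[/eqP e1 _] /andP[/eqP e2 _] e.
  by rewrite -(with_digitsK m1) -(with_digitsK m2) e e1 e2.
- move=> q /mapP[m1]; rewrite mem_filter => /andP[_ /rn /and3P[h1 h2 h3]] ->.
  by rewrite /= !ltn_divLR // -!expnSr h1 h2 h3.
(* At this exponent the words with smaller [mu] drop out by induction and the others with different
   last digits by triangularity. What remains is a nonzero constant times a relation, at [q],
   between words with one level fewer. *)
- move=> q; have := sum0 (with_digits q (rem m)).
  rewrite (bigID (fun m1 => rem m1 == rem m)) /= [X in _ + X]big1_seq ?addr0; last first.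
    move=> m1 /andP[ne m1r]; rewrite word_op_normal.
    have [lt|ge] := ltnP (mu m1) (mu m); first by rewrite IHm ?mul0r.
    have [bp1 bp] : ((rem m1).1.2 < p)%N /\ ((rem m).1.2 < p)%N by rewrite !ltn_mod.
    have [lt|gt|eq] := ltngtP (weight (rem m)) (weight (rem m1)).
    + by rewrite vanish_block ?mulr0 // is_digits_rem.
    + move: ge; rewrite leqNgt => /negP; case; rewrite /mu.
      have : (weight (rem m1) * p + p <= weight (rem m) * p)%N.
        by rewrite -mulSnr leq_mul2r gt orbT.
      lia.
    + rewrite block_op_eq0 ?mulr0 ?is_digits_rem ?eq // 1?eq_sym //.
      by move: ge; rewrite /mu eq; lia.
  pose u : K := (-1) ^+ (rem m).1.2 * ((rem m).1.1`! * (rem m).1.2`! * (rem m).2`!)%:R.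
  have u0 : u != 0 by rewrite block_op_diag_neq0 // is_digits_rem.
  move=> s0; apply: (mulfI u0); rewrite mulr0 -[RHS]s0 big_map big_filter mulr_sumr.
  apply: eq_bigr => m1 e; rewrite (c'E m1 e) word_op_normal (eqP e) block_op_diag.
  by rewrite normal_wordS word_op_shift mulrCA.
- by apply/mapP; exists m => //; rewrite mem_filter eqxx.
Qed.

End CoordinateOperators.

(** * Words without leading monomials *)

Section LeadingMonomials.
Variables (K : fieldType) (p : nat).
Hypothesis pp : prime p.

Local Notation poly := {malg K[word]}.
Local Notation al k := (false, k : nat).
Local Notation be k := (true, k : nat).

Definition mono (s : seq letter) : poly := << FMonom s >>.

Lemma monoM g g' s s' : g = mono s -> g' = mono s' -> g * g' = mono (s ++ s').
Proof.
move=> -> ->; rewrite /mono malgM_def fgmulUU mulr1; congr << _ >>.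
exact: fmmulE.
Qed.

Lemma la_mono k : la K k = mono [:: al k].
Proof. by rewrite /la fmuE. Qed.

Lemma lb_mono k : lb K k = mono [:: be k].
Proof. by rewrite /lb fmuE. Qed.

Lemma mono_nil : 1 = mono [::].
Proof. by rewrite /mono -fmoneE. Qed.

Lemma monoX g s n : g = mono s -> g ^+ n = mono (flatten (nseq n s)).
Proof.
move=> gs; elim: n => [|n IH]; first by rewrite expr0 mono_nil.
by rewrite exprS; apply: monoM.
Qed.

Lemma monoX1 g x n : g = mono [:: x] -> g ^+ n = mono (nseq n x).
Proof.
by move=> /monoX ->; congr mono; elim: n => //= n ->.
Qed.

Lemma mono_prod (F : nat -> poly) (f : nat -> seq letter) r :
  (forall i, F i = mono (f i)) ->
  \prod_(i <- r) F i = mono (flatten [seq f i | i <- r]).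
Proof.
move=> Ff; elim: r => [|i r IH]; first by rewrite big_nil mono_nil.
by rewrite big_cons; apply: monoM.
Qed.

(** The length condition gives every monomial of an element of [G] at least two letters, so
    [T1_size] does not have to determine which monomial is the leading one. *)
Definition lower t (w : word) : Prop :=
  [/\ w != FMonom t, word_le p w (FMonom t) & (1 < size w)%N].

Definition lower_terms t (h : poly) := forall w, w \in msupp h -> lower t w.

Lemma lower_termsD t h h' :
  lower_terms t h -> lower_terms t h' -> lower_terms t (h + h').
Proof.
move=> lh lh' w /(fsubsetP (msuppD_le _ _)); rewrite in_fsetU.
by case/orP => [/lh|/lh'].
Qed.

Lemma lower_termsN t h : lower_terms t h -> lower_terms t (- h).
Proof. by move=> lh w; rewrite msuppN => /lh. Qed.

Lemma lower_termsZ t c h : lower_terms t h -> lower_terms t (c *: h).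
Proof. by move=> lh w /(fsubsetP (msuppZ_le _ _)) /lh. Qed.

Lemma lower_terms_mono t s : lower t (FMonom s) -> lower_terms t (mono s).
Proof. by move=> ls w; rewrite /mono msuppU oner_eq0 in_fset1 => /eqP ->. Qed.

Lemma lower_terms0 t : lower_terms t 0.
Proof. by move=> w; rewrite msupp0 in_fset0. Qed.

Definition leads t (g : poly) :=
  (1 < size t)%N /\ exists2 h, g = mono t + h & lower_terms t h.

Lemma leads_sub t u v c g1 g2 g3 : (1 < size t)%N ->
  g1 = mono t -> g2 = mono u -> g3 = mono v ->
  lower t (FMonom u) -> lower t (FMonom v) -> leads t (g1 - g2 + c *: g3).
Proof.
move=> st -> -> -> lu lv; split=> //; exists (- mono u + c *: mono v).
  by rewrite addrA.
apply: lower_termsD; first exact/lower_termsN/lower_terms_mono.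
exact/lower_termsZ/lower_terms_mono.
Qed.

Lemma leads_sub2 t u v c g1 g2 g3 : (1 < size t)%N ->
  g1 = mono t -> g2 = mono u -> g3 = mono v ->
  lower t (FMonom u) -> lower t (FMonom v) -> leads t (g1 - g2 - c *: g3).
Proof. by rewrite -scaleNr; exact: leads_sub. Qed.

Lemma leads_sub3 t u v c g1 g2 g3 : (1 < size t)%N ->
  g1 = mono t -> g2 = mono u -> g3 = mono v ->
  lower t (FMonom u) -> lower t (FMonom v) -> leads t (g1 - c *: g2 + g3).
Proof.
move=> st -> -> -> lu lv; split=> //; exists (- (c *: mono u) + mono v).
  by rewrite addrA.
apply: lower_termsD; last exact/lower_terms_mono.
exact/lower_termsN/lower_termsZ/lower_terms_mono.
Qed.

Lemma leads_sub1 t u g1 g2 : (1 < size t)%N ->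
  g1 = mono t -> g2 = mono u -> lower t (FMonom u) -> leads t (g1 - g2).
Proof.
move=> st -> -> lu; split=> //; exists (- mono u); first by [].
exact/lower_termsN/lower_terms_mono.
Qed.

Lemma leads_is_lead t g : leads t g -> is_lead p g (FMonom t).
Proof.
case=> _ [h -> lh]; split.
  rewrite -mcoeff_neq0 mcoeffD mcoeffUU; have [/lh[]|_] := msuppP h.
    by rewrite eqxx.
  by rewrite addr0 oner_eq0.
move=> w /(fsubsetP (msuppD_le _ _)); rewrite in_fsetU msuppU oner_eq0 in_fset1.
by case/orP => [/eqP ->|/lh[]//]; rewrite /word_le eqxx lexx orbT.
Qed.

Lemma leads_size t g w : leads t g -> w \in msupp g -> (1 < size w)%N.
Proof.
case=> st [h -> lh] /(fsubsetP (msuppD_le _ _)).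
rewrite in_fsetU msuppU oner_eq0 in_fset1.
by case/orP => [/eqP ->|/lh[]].
Qed.

Definition Deg (s : seq letter) : nat := \sum_(x <- s) p ^ x.2.

Lemma Deg_cat s s' : Deg (s ++ s') = (Deg s + Deg s')%N.
Proof. exact: big_cat. Qed.

Lemma Deg_cons x s : Deg (x :: s) = (p ^ x.2 + Deg s)%N.
Proof. exact: big_cons. Qed.

Lemma Deg_nil : Deg [::] = 0%N.
Proof. exact: big_nil. Qed.

Lemma Deg_nseq n x : Deg (nseq n x) = (n * p ^ x.2)%N.
Proof. by elim: n => [|n IH]; rewrite ?Deg_nil //= Deg_cons IH. Qed.

Lemma Deg_flatten_nseq n s : Deg (flatten (nseq n s)) = (n * Deg s)%N.
Proof. by elim: n => [|n IH]; rewrite ?Deg_nil //= Deg_cat IH. Qed.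

(** The geometric sum of [(p - 1) p^i] over [k <= i < l]. It is the reason why the long correction
    terms of [G] have the same [Deg] as the leading monomials. *)
Lemma Deg_digits (b : bool) k l : (k <= l)%N ->
  (Deg (flatten [seq nseq p.-1 (b, i) | i <- index_iota k l]) + p ^ k = p ^ l)%N.
Proof.
move=> kl; rewrite /index_iota -{2}(subnKC kl); elim: (l - k)%N => [|n IH].
  by rewrite /= Deg_nil addn0.
rewrite -{1}addn1 iotaD map_cat flatten_cat Deg_cat addnAC IH /= cats0 Deg_nseq /=.
by rewrite -mulSn prednK ?prime_gt0 // -expnS addnS.
Qed.

(** At equal [Deg] the order is decided by the first letters; [x] and [y] only serve as defaults of
    [head]. *)
Lemma lower_head x y s t :
  (letter_rank (head x s) < letter_rank (head y t))%N ->
  Deg s = Deg t -> (1 < size s)%N -> (0 < size t)%N -> lower t (FMonom s).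
Proof.
case: s t => [//|x' s] [//|y' t] /= xy dE s0 _; split=> //.
  by apply/eqP => -[e _]; rewrite e ltnn in xy.
rewrite /word_le -![word_Deg _ _]/(Deg _) dE ltnn eqxx /=.
by rewrite lexi_cons !leEnat (ltnW xy) leqNgt xy.
Qed.

(** Serves the comparison of [b_k a_k b_k] with [b_k b_k a_k], which share their first letter. *)
Lemma lower_cons x s t :
  lower t (FMonom s) -> Deg s = Deg t -> lower (x :: t) (FMonom (x :: s)).
Proof.
case=> ne le sz dE; split=> [||/=]; last exact: ltnW.
  by apply: contra ne => /eqP[->].
move: le; rewrite /word_le -![word_Deg _ _]/(Deg _) !Deg_cons dE !ltnn !eqxx /=.
by move=> le; rewrite lexi_cons lexx le implybT.
Qed.

Lemma predp : p.-1 = p.-2.+1.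
Proof. by case: p (prime_gt1 pp) => [|[]]. Qed.

Lemma head_nseq_cat n (x y : letter) s : head y (nseq n.+1 x ++ s) = x.
Proof. by []. Qed.

Lemma leads_ab k l : (k < l)%N -> leads [:: al l; be k]
  (la K l * lb K k - lb K k * la K l
   + (-1) ^+ (l - k) *: (la K k ^+ p.-1 * lb K k * la K k
                         * \prod_(k.+1 <= i < l) la K i ^+ p.-1)).
Proof.
move=> kl; apply: leads_sub => //.
- exact: monoM (la_mono l) (lb_mono k).
- exact: monoM (lb_mono k) (la_mono l).
- apply: monoM; last by apply: mono_prod => i; exact: monoX1 (la_mono i).
  exact: monoM (monoM (monoX1 _ (la_mono k)) (lb_mono k)) (la_mono k).
- apply: (@lower_head (al 0) (al 0)) => //; last by rewrite !Deg_cons addnCA.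
  by rewrite /letter_rank /=; lia.
- apply: (@lower_head (al 0) (al 0)) => //.
  + by rewrite -!catA predp head_nseq_cat /letter_rank /=; lia.
  + have := Deg_digits false kl; rewrite !Deg_cat !Deg_cons !Deg_nil Deg_nseq !addn0 /=.
    have e : (p.-1 * p ^ k + p ^ k = p ^ k.+1)%N.
      by rewrite -mulSnr prednK ?prime_gt0 // -expnS.
    by move=> <-; rewrite e addnAC; congr (_ + _)%N; rewrite addnC.
  + by rewrite !size_cat /= size_nseq; lia.
Qed.

Lemma leads_ba k l : (k < l)%N -> leads [:: be l; al k]
  (lb K l * la K k - la K k * lb K l
   - (-1) ^+ (l - k) *: (lb K k * la K k * \prod_(k <= i < l) lb K i ^+ p.-1)).
Proof.
move=> kl; apply: leads_sub2 => //.
- exact: monoM (lb_mono l) (la_mono k).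
- exact: monoM (la_mono k) (lb_mono l).
- apply: monoM; last by apply: mono_prod => i; exact: monoX1 (lb_mono i).
  exact: monoM (lb_mono k) (la_mono k).
- apply: (@lower_head (al 0) (al 0)) => //; last by rewrite !Deg_cons addnCA.
  by rewrite /letter_rank /=; lia.
- apply: (@lower_head (al 0) (al 0)) => //.
    by rewrite /letter_rank /=; lia.
  have := Deg_digits true (ltnW kl).
  rewrite !Deg_cat !Deg_cons !Deg_nil !addn0 /= => <-.
  by move: (Deg _) (p ^ k)%N => D q; lia.
Qed.

Lemma leads_comm (b : bool) k l g g' : (k < l)%N ->
  g = mono [:: (b, l)] -> g' = mono [:: (b, k)] ->
  leads [:: (b, l); (b, k)] (g * g' - g' * g).
Proof.
move=> kl gl gk; apply: (leads_sub1 _ (monoM gl gk) (monoM gk gl)); first by [].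
apply: (@lower_head (al 0) (al 0)); rewrite ?size_cat //=.
  by rewrite /letter_rank /= ltn_add2r ltn_double.
by rewrite !Deg_cons addnCA.
Qed.

Lemma leads_baX k : leads (flatten (nseq p [:: be k; al k]))
  ((lb K k * la K k) ^+ p - (la K k * lb K k) ^+ p).
Proof.
have pE : p = p.-1.+1 by rewrite prednK ?prime_gt0.
have sz s : size (flatten (nseq p s)) = (p * size s)%N.
  by rewrite size_flatten /shape map_nseq sumn_nseq mulnC.
have sz2 : (1 < p * 2)%N by rewrite (leq_trans (prime_gt1 pp)) // leq_pmulr.
apply: leads_sub1; first by rewrite sz.
- exact: monoX (monoM (lb_mono k) (la_mono k)).
- exact: monoX (monoM (la_mono k) (lb_mono k)).
apply: (@lower_head (al 0) (al 0)).
- by rewrite pE /= /letter_rank /=; lia.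
- by rewrite !Deg_flatten_nseq !Deg_cons addnCA.
- by rewrite sz.
- by rewrite sz ltnW.
Qed.

Lemma leads_X x k g : g = mono [:: (x, k)] -> leads (nseq p (x, k)) (g ^+ p).
Proof.
move=> gx; split; first by rewrite size_nseq prime_gt1.
exists 0; last exact: lower_terms0.
by rewrite addr0; exact: monoX1.
Qed.

Lemma leads_bba k : leads [:: be k; be k; al k]
  (lb K k ^+ 2 * la K k - 2%:R *: (lb K k * la K k * lb K k) + la K k * lb K k ^+ 2).
Proof.
have b2 : lb K k ^+ 2 = mono [:: be k; be k] := monoX1 2 (lb_mono k).
apply: (@leads_sub3 [:: be k; be k; al k] [:: be k; al k; be k]
  [:: al k; be k; be k] 2%:R _ _ _ isT (monoM b2 (la_mono k))
  (monoM (monoM (lb_mono k) (la_mono k)) (lb_mono k)) (monoM (la_mono k) b2)).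
- apply: (@lower_cons (be k) [:: al k; be k] [:: be k; al k]).
    apply: (@lower_head (al 0) (al 0) [:: al k; be k]); rewrite ?ltnn //.
      by rewrite /letter_rank ltn_add2l.
    by rewrite !Deg_cons !Deg_nil addnCA.
  by rewrite !Deg_cons !Deg_nil addnCA.
- apply: (@lower_head (al 0) (al 0) [:: al k; be k; be k]) => //.
    by rewrite /letter_rank ltn_add2l.
  by rewrite !Deg_cons !Deg_nil /=; lia.
Qed.

Lemma leads_baa k : leads [:: be k; al k; al k]
  (lb K k * la K k ^+ 2 - 2%:R *: (la K k * lb K k * la K k) + la K k ^+ 2 * lb K k).
Proof.
have a2 : la K k ^+ 2 = mono [:: al k; al k] := monoX1 2 (la_mono k).
apply: (@leads_sub3 [:: be k; al k; al k] [:: al k; be k; al k]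
  [:: al k; al k; be k] 2%:R _ _ _ isT (monoM (lb_mono k) a2)
  (monoM (monoM (la_mono k) (lb_mono k)) (la_mono k)) (monoM a2 (lb_mono k))).
- apply: (@lower_head (al 0) (al 0) [:: al k; be k; al k]) => //.
    by rewrite /letter_rank ltn_add2l.
  by rewrite !Deg_cons !Deg_nil /=; lia.
- apply: (@lower_head (al 0) (al 0) [:: al k; al k; be k]) => //.
    by rewrite /letter_rank ltn_add2l.
  by rewrite !Deg_cons !Deg_nil /=; lia.
Qed.

Lemma T1_size t : T1 p K t -> (1 < size t)%N.
Proof.
case=> g Gg [tg _].
suff [s] : exists s, leads s g by move=> /leads_size; apply.
case: Gg => [[k [l [kl]]]|[[k]|[_ [k]]]].
- case=> ->.
  + by exists [:: al l; be k]; exact: leads_ab.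
  + by exists [:: be l; al k]; exact: leads_ba.
  + by eexists; exact: leads_comm kl (la_mono l) (la_mono k).
  + by eexists; exact: leads_comm kl (lb_mono l) (lb_mono k).
- case=> ->.
  + by eexists; exact: leads_baX.
  + by eexists; exact: leads_X (la_mono k).
  + by eexists; exact: leads_X (lb_mono k).
- case=> ->; first by eexists; exact: leads_bba.
  by eexists; exact: leads_baa.
Qed.

(* The conditions on a word given by the leading monomials of [G]. For [p = 2]
   the last two follow from [a_k^p] and [b_k^p]. *)
Definition reduced (s : seq letter) : Prop :=
  [/\ forall x y : letter, infix [:: x; y] s -> (x.2 <= y.2)%N,
      forall x, ~~ infix (nseq p x) s,
      forall k, ~~ infix (flatten (nseq p [:: be k; al k])) s,
      forall k, ~~ infix [:: be k; be k; al k] s &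
      forall k, ~~ infix [:: be k; al k; al k] s].

Lemma M_reduced (w : word) : M p K w -> reduced w.
Proof.
move=> Mw.
have avoid s g : leads s g -> Defs.G p g -> ~~ infix s w.
  by move=> /leads_is_lead ls Gg; apply: (Mw (FMonom s)); exists g.
have powers x : ~~ infix (nseq p x) w.
  case: x => [[] k].
    apply: avoid (leads_X (lb_mono k)) _; right; left; exists k.
    by constructor 3.
  apply: avoid (leads_X (la_mono k)) _; right; left; exists k.
  by constructor 2.
have p2 x : p = 2%N -> ~~ infix [:: x; x] w.
  by move=> pE; have := powers x; rewrite pE.
split=> // [[b l] [c k] /= h|k|k|k].
- rewrite leqNgt; apply: contraL h => kl.
  case: b c => [] [].
  + apply: avoid (leads_comm kl (lb_mono l) (lb_mono k)) _.
    by left; exists k, l; split=> //; constructor 4.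
  + by apply: avoid (leads_ba kl) _; left; exists k, l; split=> //; constructor 2.
  + by apply: avoid (leads_ab kl) _; left; exists k, l; split=> //; constructor 1.
  + apply: avoid (leads_comm kl (la_mono l) (la_mono k)) _.
    by left; exists k, l; split=> //; constructor 3.
- by apply: avoid (leads_baX k) _; right; left; exists k; constructor 1.
- have [p3|] := ltnP 2 p; last first.
    move=> p2'; have /p2 - /(_ (be k)) : p = 2%N.
      by apply/eqP; rewrite eqn_leq p2' prime_gt1.
    apply: contra; apply: infix_trans; exact: (prefix_infix [:: be k; be k] [:: al k]).
  apply: avoid (leads_bba k) _; right; right; split=> //; exists k; by left.
- have [p3|] := ltnP 2 p; last first.
    move=> p2'; have /p2 - /(_ (al k)) : p = 2%N.
      by apply/eqP; rewrite eqn_leq p2' prime_gt1.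
    apply: contra; apply: infix_trans; exact: (suffix_infix [:: be k] [:: al k; al k]).
  apply: avoid (leads_baa k) _; right; right; split=> //; exists k; by right.
Qed.

Lemma reduced_infix s s' : infix s' s -> reduced s -> reduced s'.
Proof.
move=> ss [h1 h2 h3 h4 h5]; have tr u : infix u s' -> infix u s.
  by move=> us; apply: infix_trans us ss.
split=> [x y /tr/h1//|x|k|k|k]; apply/negP => /tr.
- by apply/negP.
- exact/negP/h3.
- exact/negP/h4.
- exact/negP/h5.
Qed.

Lemma reduced_level k s : reduced s -> all (fun x => x.2 == k) s ->
  exists a b c, [/\ (a < p)%N, (b < p)%N, (c < p)%N &
    s = nseq a (al k) ++ flatten (nseq b [:: be k; al k]) ++ nseq c (be k)].
Proof.
move=> rs sk.
suff [a [b [c sE]]] : exists a b c,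
    s = nseq a (al k) ++ flatten (nseq b [:: be k; al k]) ++ nseq c (be k).
  exists a, b, c; case: rs => _ h2 h3 _ _; split=> //.
  - rewrite ltnNge; apply: contra (h2 (al k)) => /subnKC e.
    by rewrite sE -e nseqD -catA prefix_infix.
  - rewrite ltnNge; apply: contra (h3 k) => /subnKC e.
    by rewrite sE -e nseqD flatten_cat -catA infix_infix.
  - rewrite ltnNge; apply: contra (h2 (be k)) => /subnKC e.
    by rewrite sE -e nseqD catA infix_infix.
(* The word grows at its left end. A new [a] always fits; a new [b] opens a pair [b a] if exactly
   one single [a] stands in front, and joins the final run if no [a] occurs; otherwise it creates
   [b b a] or [b a a]. *)
elim: s rs sk => [|[x l] s IH] rs /=; first by exists 0%N, 0%N, 0%N.
case/andP => /eqP lk sk; subst l.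
have [|a [b [c sE]]] := IH _ sk; first exact: reduced_infix (infix_cons _ _) rs.
have [_ _ _ h4 h5] := rs.
case: x rs h4 h5 => rs h4 h5; last by exists a.+1, b, c; rewrite sE.
case: a sE => [|[|a]] sE.
- case: b sE => [|b] sE; first by exists 0%N, 0%N, c.+1; rewrite sE.
  case/negP: (h4 k); rewrite sE; exact: (prefix_infix [:: be k; be k; al k]).
- by exists 0%N, b.+1, c; rewrite sE.
- case/negP: (h5 k); rewrite sE; exact: (prefix_infix [:: be k; al k; al k]).
Qed.

Lemma reduced_split k s : reduced s -> all (fun x => k <= x.2)%N s ->
  exists s0 s1, [/\ s = s0 ++ s1, all (fun x => x.2 == k) s0 &
    all (fun x => k < x.2)%N s1].
Proof.
elim: s => [|x s IH] rs /=; first by exists [::], [::].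
case/andP => kx sk.
have [|s0 [s1 [sE a0 a1]]] := IH _ sk; first exact: reduced_infix (infix_cons _ _) rs.
move: kx; rewrite leq_eqVlt => /orP[kx|kx].
  by exists (x :: s0), s1; rewrite sE /= eq_sym kx.
case: s0 sE a0 => [|y s0] sE a0.
  by exists [::], (x :: s1); rewrite sE /= kx.
have [h1 _ _ _ _] := rs; have /h1 : infix [:: x; y] (x :: s).
  by rewrite sE; exact: (prefix_infix [:: x; y]).
by case/andP: a0 => /eqP -> _; rewrite leqNgt kx.
Qed.

Lemma reduced_normal n k s : reduced s ->
  all (fun x => k <= x.2 < k + n)%N s ->
  exists m, [&& m.1.1 < p ^ n, m.1.2 < p ^ n & m.2 < p ^ n]%N /\
    s = normal_word p n k m.
Proof.
elim: n k s => [|n IH] k s rs sk.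
  exists (0, 0, 0)%N; split=> //; case: s sk {rs} => //= x s.
  by rewrite addn0 ltnNge andbN.
have [|s0 [s1 [sE a0 a1]]] := @reduced_split k s rs.
  by apply: sub_all sk => x /andP[].
have r0 : reduced s0 by apply: reduced_infix rs; rewrite sE prefix_infix.
have r1 : reduced s1 by apply: reduced_infix rs; rewrite sE suffix_infix.
have [a [b [c [ap bp cp s0E]]]] := reduced_level r0 a0.
have [|[[i j] l] [/and3P[/= hi hj hl] s1E]] := IH k.+1 s1 r1.
  move: sk; rewrite sE all_cat => /andP[_] sk; apply/allP => x xs.
  by rewrite (allP a1 x xs) addSnnS; case/andP: (allP sk x xs).
have bound d q : (d < p)%N -> (q < p ^ n)%N -> (d + q * p < p ^ n.+1)%N.
  move=> dp qn; rewrite (@leq_trans (q.+1 * p)) ?mulSn ?ltn_add2r //.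
  by rewrite -mulSn expnSr leq_mul2r qn orbT.
have modE d q : (d < p)%N -> ((d + q * p) %% p = d)%N.
  by move=> dp; rewrite addnC modnMDl modn_small.
have divE d q : (d < p)%N -> ((d + q * p) %/ p = q)%N.
  by move=> dp; rewrite addnC divnMDl ?prime_gt0 // divn_small // addn0.
exists (a + i * p, b + j * p, c + l * p)%N; split; first by rewrite /= !bound.
by rewrite /= /quo /= !modE // !divE // sE s0E s1E -!catA.
Qed.

End LeadingMonomials.

(** * Graded submodules *)

Section GradedSubmodules.
Variables (R : nzRingType) (P : lmodType R) (S : Type) (H : S -> set P).
Variable N : set P.

Definition homog_sums (v : P) : Prop := exists s : seq P,
  (forall w, w \in s -> N w /\ exists d, H d w) /\ v = \sum_(w <- s) w.

Lemma homog_sums1 d v : N v -> H d v -> homog_sums v.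
Proof.
move=> Nv Hv; exists [:: v]; rewrite big_seq1; split=> // w.
by rewrite inE => /eqP ->; split=> //; exists d.
Qed.

Lemma homog_sums_sum I (r : seq I) (f : I -> P) :
  (forall i, homog_sums (f i)) -> homog_sums (\sum_(i <- r) f i).
Proof.
move=> hf; elim/big_rec: _ => [|i v _ [s [hs ->]]].
  by exists [::]; rewrite big_nil.
have [s' [hs' ->]] := hf i; exists (s' ++ s); rewrite big_cat; split=> // w.
by rewrite mem_cat => /orP[/hs'|/hs].
Qed.

Hypothesis gN : graded_submodule H N.

Lemma graded_submodule0 : N 0. Proof. by case: gN. Qed.

Lemma graded_submoduleD u v : N u -> N v -> N (u + v).
Proof. by case: gN => _ NL _ Nu Nv; have := NL 1 u v Nu Nv; rewrite scale1r. Qed.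

Lemma graded_submoduleZ a u : N u -> N (a *: u).
Proof.
by case: gN => N0 NL _ Nu; have := NL a u 0 Nu N0; rewrite addr0.
Qed.

Lemma graded_submoduleB u v : N u -> N v -> N (u - v).
Proof.
by move=> Nu Nv; apply: graded_submoduleD => //; rewrite -scaleN1r; exact: graded_submoduleZ.
Qed.

Lemma graded_submodule_sum I (r : seq I) (Q : pred I) (f : I -> P) :
  (forall i, Q i -> N (f i)) -> N (\sum_(i <- r | Q i) f i).
Proof.
move=> hf; elim/big_rec: _ => [|i v Qi Nv]; first exact: graded_submodule0.
by apply: graded_submoduleD => //; exact: hf.
Qed.

End GradedSubmodules.

Section MalgScale.
Variables (T : choiceType) (R : nzRingType) (V : lmodType R) (h : T -> R -> V).
Hypothesis hD : forall k, {morph h k : x y / x + y}.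
Hypothesis hZ : forall k a c, h k (a * c) = a *: h k c.

Lemma malg_sumZ a f : malg_sum h (a *: f) = a *: malg_sum h f.
Proof.
rewrite (malg_sumEw hD (msuppZ_le a f)) /malg_sum scaler_sumr.
by apply: eq_bigr => k _; rewrite mcoeffZ hZ.
Qed.

End MalgScale.

(** * Minimality *)

Section AlgebraCoordinates.
Variables (F : numFieldType) (U : algType F) (iota : {linear sl3p F -> U}).
Variables (K : fieldType) (p : nat) (A : algType K) (phi : U -> A).
Hypothesis env : is_enveloping iota.
Hypothesis ext : is_scalar_extension iota phi.
Hypothesis pK : p \in [pchar K].
Variable g : {linear A -> {malg K[exponent]}}.
Hypothesis g_pbw : forall m, g (phi (pbw iota m)) = << m >>.
Hypothesis g_span : forall a,
  a = \sum_(m <- msupp (g a)) (g a)@_m *: phi (pbw iota m).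

Let p_gt0 : (0 < p)%N. Proof. exact/prime_gt0/(pcharf_prime pK). Qed.

Local Notation E m := (phi (pbw iota m)).
Local Notation exp0 := (0, 0, 0)%N.

Definition coef (a : A) (m : exponent) : K := (g a)@_m.

Lemma coefD a b m : coef (a + b) m = coef a m + coef b m.
Proof. by rewrite /coef raddfD mcoeffD. Qed.

Lemma coef0 m : coef 0 m = 0.
Proof. by rewrite /coef raddf0 mcoeff0. Qed.

Lemma coefZ c a m : coef (c *: a) m = c * coef a m.
Proof. by rewrite /coef linearZ mcoeffZ. Qed.

Lemma coefN a m : coef (- a) m = - coef a m.
Proof. by rewrite -scaleN1r coefZ mulN1r. Qed.

Lemma coef_sum I (r : seq I) (f : I -> A) m :
  coef (\sum_(i <- r) f i) m = \sum_(i <- r) coef (f i) m.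
Proof.
exact: (big_morph (coef ^~ m) (fun a b => coefD a b m) (coef0 m)).
Qed.

Lemma coefE m m' : coef (E m) m' = (m == m')%:R.
Proof. by rewrite /coef g_pbw mcoeffU. Qed.

Lemma coef_inj a b : (forall m, coef a m = coef b m) -> a = b.
Proof.
move=> ab; rewrite [a]g_span [b]g_span.
by have -> : g a = g b by apply/malgP => m; exact: ab.
Qed.

Lemma coef1 m : coef 1 m = coord1 K m.
Proof. by rewrite -(phi_pbw0 ext) coefE eq_sym. Qed.

Lemma coefM a b m : coef (a * b) m = \sum_(m1 <- msupp (g a))
  \sum_(m2 <- msupp (g b)) coef a m1 * coef b m2 * coef (E m1 * E m2) m.
Proof.
rewrite {1}[a]g_span {1}[b]g_span mulr_suml coef_sum; apply: eq_bigr => m1 _.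
rewrite mulr_sumr coef_sum; apply: eq_bigr => m2 _.
by rewrite -scalerAl coefZ -scalerAr coefZ mulrA.
Qed.

Definition letter_exp (x : letter) : exponent :=
  if x.1 then (0, 0, p ^ x.2)%N else (p ^ x.2, 0, 0)%N.

Lemma letter_valE x : letter_val iota p phi x = E (letter_exp x).
Proof.
rewrite /letter_val /letter_exp /pbw; congr phi.
rewrite -![divpow _ _ _]/(dpow (iota _) _).
by case: x.1 => /=; rewrite !dpow0 ?mulr1 ?mul1r.
Qed.

Lemma letter_op_linear x I (r : seq I) (c : I -> K) (v : I -> exponent -> K) m :
  letter_op p x (fun m => \sum_(i <- r) c i * v i m) m =
  \sum_(i <- r) c i * letter_op p x (v i) m.
Proof.
rewrite /letter_op; case: x.1.
  rewrite /yop; under eq_bigr do rewrite mulr_sumr.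
  rewrite exchange_big; apply: eq_bigr => i _; rewrite mulr_sumr.
  by apply: eq_bigr => s _; rewrite mulrCA.
by rewrite /xop mulr_sumr; apply: eq_bigr => i _; rewrite mulrCA.
Qed.

(** By linearity it suffices to take a PBW element for [a], where [prod_coef] reduces to one or two
    binomials. The range distinctions exclude exponents that would agree only through truncated
    subtraction. *)
Lemma coef_letter x a m :
  coef (letter_val iota p phi x * a) m = letter_op p x (coef a) m.
Proof.
have aE : coef a = fun m => \sum_(m1 <- msupp (g a)) coef a m1 * coef (E m1) m.
  apply/funext => m'; rewrite {1}[a]g_span coef_sum.
  by apply: eq_bigr => m1 _; rewrite coefZ.
rewrite aE letter_op_linear {1}[a]g_span mulr_sumr coef_sum; apply: eq_bigr => m1 _.
rewrite -scalerAr coefZ -/(coef a m1) letter_valE (phi_pbw_mul env ext) coef_sum.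
congr (_ * _); rewrite /letter_exp /letter_op; case: m1 => [[i j] l].
case: m => [[i' j'] l']; case: x.1 => /=; move: (p ^ x.2)%N => q.
  rewrite /yop /=; apply: eq_bigr => s _; rewrite coefZ !coefE /prod_coef /prod_exp /=.
  rewrite !xpair_eqE !add0n !bin0 !mul1n; case: ifP => si; last first.
    rewrite mul0r; case: (leqP s j') => sj; last by rewrite bin_small ?mul0n ?mulr0 ?mul0r.
    have -> : (i == i' + s)%N = false by apply/eqP; lia.
    by rewrite mulr0.
  case: (leqP s j') => sj; last first.
    have -> : (j + s == j')%N = false by apply/eqP; lia.
    by rewrite andbF mulr0 bin_small // mul0n mulr0 mul0r.
  case: (leqP (q - s) l') => sl; last first.
    have -> : (q - s + l == l')%N = false by apply/eqP; lia.
    by rewrite andbF mulr0 [X in (_ * X)%N]bin_small // muln0 mulr0 mul0r.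
  have -> : (i - s == i')%N = (i == i' + s)%N by lia.
  have -> : (j + s == j')%N = (j == j' - s)%N by lia.
  have -> : (q - s + l == l')%N = (l == l' - (q - s))%N by lia.
  case: (j =P _) => [->|_]; last by rewrite andbF !mulr0.
  case: (l =P _) => [->|_]; last by rewrite !andbF !mulr0.
  rewrite !andbT subnK // subnKC // bin_sub //.
  by rewrite intrM rmorphXn /= rmorphN1 -pmulrn.
rewrite big_ord1 coefZ !coefE /prod_coef /prod_exp /=.
rewrite !xpair_eqE !subn0 !addn0 !add0n !bin0 binn !muln1 expr0 mul1r.
case: (leqP q i') => qi; last first.
  have -> : (q + i == i')%N = false by apply/eqP; lia.
  by rewrite mulr0 /xop /= bin_small // mul0r.
have -> : (q + i == i')%N = (i == i' - q)%N by lia.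
rewrite /xop /= coefE !xpair_eqE.
by case: (i =P _) => [->|_]; rewrite ?mulr0 // subnKC // -pmulrn.
Qed.

Lemma coef_word (w : word) m : coef (word_val iota p phi w) m = word_op K p w m.
Proof.
rewrite /word_val; case: w => s /=; elim: s m => [|x s IH] m.
  by rewrite big_nil coef1.
rewrite big_cons coef_letter /=; congr (letter_op _ _ _ _).
by apply/funext => m'; exact: IH.
Qed.

(** * The grading of [A] in PBW coordinates and the augmentation ideal *)

Definition exp_deg (m : exponent) : nat * nat := (m.1.1 + m.1.2, m.1.2 + m.2)%N.

Definition homog (r : nat * nat) (a : A) := forall m, exp_deg m != r -> coef a m = 0.

Lemma A_degP r a : A_deg iota phi r a <-> homog r a.
Proof.
split=> [[f [fr ->]] m mr|ha].
  rewrite coef_sum big1_seq // => m1 /andP[_ m1f]; rewrite coefZ coefE.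
  by case: eqP => [m1m|_]; rewrite ?mulr0 //; rewrite -m1m -(fr _ m1f) eqxx in mr.
exists (g a); split; last exact: g_span.
move=> m; rewrite -mcoeff_neq0 => ga; apply/eqP; apply: contraNT ga => mr.
exact/eqP/ha.
Qed.

Lemma homog0 r : homog r 0.
Proof. by move=> m _; exact: coef0. Qed.

Lemma homogD r a b : homog r a -> homog r b -> homog r (a + b).
Proof. by move=> ha hb m mr; rewrite coefD ha ?hb ?addr0. Qed.

Lemma homogZ r c a : homog r a -> homog r (c *: a).
Proof. by move=> ha m mr; rewrite coefZ ha ?mulr0. Qed.

Lemma homogE m : homog (exp_deg m) (E m).
Proof. by move=> m' mr; rewrite coefE; case: (m =P m') mr => [->|//]; rewrite eqxx. Qed.

Lemma homogM_pbw m1 m2 : homog (exp_deg m1 + exp_deg m2) (E m1 * E m2).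
Proof.
rewrite (phi_pbw_mul env ext) => m mr; rewrite coef_sum big1 // => s _.
rewrite coefZ coefE /prod_coef; case: ifP => [si|_]; last by rewrite mul0r.
case: eqP => [em|_]; last by rewrite mulr0.
case/eqP: mr; rewrite -em /prod_exp /exp_deg /= /GRing.add /= /add_pair /=.
have := ltn_ord s; rewrite ltnS => sl.
by congr pair; rewrite /GRing.add /=; lia.
Qed.

Lemma homogM r s a b : homog r a -> homog s b -> homog (r + s) (a * b).
Proof.
move=> ha hb m mrs; rewrite coefM big1 // => m1 _; rewrite big1 // => m2 _.
have [e1|ne1] := eqVneq (exp_deg m1) r; last by rewrite ha ?mul0r.
have [e2|ne2] := eqVneq (exp_deg m2) s; last by rewrite hb ?mulr0 ?mul0r.
by rewrite homogM_pbw ?mulr0 // e1 e2.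
Qed.

Lemma exp_deg_eq0 m : exp_deg m = 0 -> m = exp0.
Proof. by case: m => [[i j] l] [] /= h1 h2; congr (_, _, _); lia. Qed.

Lemma coefM0 a b : coef b exp0 = 0 -> coef (a * b) exp0 = 0.
Proof.
move=> b0; rewrite coefM big1 // => m1 _; rewrite big1 // => m2 _.
have [->|ne] := eqVneq m2 exp0; first by rewrite b0 mulr0 mul0r.
rewrite homogM_pbw ?mulr0 //; apply: contraNneq ne => e; apply/eqP/exp_deg_eq0.
have [] : (exp_deg m1).1 + (exp_deg m2).1 = 0 /\ (exp_deg m1).2 + (exp_deg m2).2 = 0.
  by move: e; rewrite /GRing.add /=; case.
by rewrite /exp_deg /GRing.add /= => h1 h2; congr pair; lia.
Qed.

Lemma homog_scalar a : homog 0 a -> a = (coef a exp0)%:A.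
Proof.
move=> ha; apply: coef_inj => m; rewrite coefZ coef1 /coord1.
have [->|ne] := eqVneq m exp0; first by rewrite mulr1.
by rewrite mulr0 ha //; apply: contraNneq ne => /exp_deg_eq0/eqP.
Qed.

Lemma homog_letter x : homog (letter_deg p x) (letter_val iota p phi x).
Proof.
rewrite letter_valE; suff -> : letter_deg p x = exp_deg (letter_exp x) by exact: homogE.
by rewrite /letter_deg /letter_exp /exp_deg; case: x.1; rewrite /= ?addn0.
Qed.

Lemma homog_word (w : word) : homog (word_deg p w) (word_val iota p phi w).
Proof.
rewrite /word_deg /word_val; case: w => s /=; elim: s => [|x s IH].
  by have := @homogE exp0; rewrite (phi_pbw0 ext) !big_nil.
by rewrite !big_cons; apply: homogM => //; exact: homog_letter.
Qed.

Lemma word_op0 x s : word_op K p (x :: s) exp0 = 0.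
Proof.
have q0 : (0 < p ^ x.2)%N by rewrite expn_gt0 p_gt0.
rewrite /= /letter_op; case: x.1; move: q0; case: (p ^ x.2)%N => // q _; last first.
  by rewrite /xop /= mul0r.
rewrite /yop big1 // => -[[|s'] hs] _ /=; rewrite ?mulr0 ?mul0r //.
Qed.

Lemma bin_pexp k k' : k != k' -> 'C(p ^ k, p ^ k')%:R = 0 :> K.
Proof.
elim: k k' => [|k IH] [|k'] // ne.
- by rewrite bin_small // ltn_exp2l ?(prime_gt1 (pcharf_prime pK)).
- rewrite expnS bin_mulp // expn0 dvdn1.
  by case: eqP => // p1; move: (prime_gt1 (pcharf_prime pK)); rewrite p1.
- by rewrite !expnS bin_mulp // dvdn_mulr // mulKn // IH.
Qed.

(* Products of at least two letters have no component on the letters: the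
   binomial coefficients [C(p^k, p^k')] vanish for [k' != k]. *)
Lemma word_op_letter y s x : (1 < size (y :: s))%N ->
  word_op K p (y :: s) (letter_exp x) = 0.
Proof.
case: s => // z s _; rewrite [LHS]/= -/(word_op K p (z :: s)).
set v := word_op K p (z :: s); have v0 : v exp0 = 0 by exact: word_op0.
have q0 k : (0 < p ^ k)%N by rewrite expn_gt0 p_gt0.
case: x y => [b k] [b' k']; rewrite /letter_op /letter_exp /=; case: b' => /=.
  rewrite /yop big1 // => -[s' hs] _ /=; case: b => /=; last first.
    rewrite !bin0n; case: s' hs => [|s'] hs; last by rewrite mul0n mulr0 mul0r.
    by rewrite subn0 (gtn_eqF (q0 k')) muln0 mulr0 mul0r.
  case: s' hs => [|s'] hs; last by rewrite bin0n mul0n mulr0 mul0r.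
  rewrite bin0 mul1n subn0; have [->|ne] := eqVneq k k'.
    by rewrite !subnn [X in _ * X]v0 mulr0.
  by rewrite bin_pexp ?mulr0 ?mul0r.
rewrite /xop; case: b => /=; first by rewrite bin0n (gtn_eqF (q0 k')) mul0r.
have [->|ne] := eqVneq k k'; first by rewrite subnn [X in _ * X]v0 mulr0.
by rewrite bin_pexp ?mul0r.
Qed.

Lemma letter_exp_inj : injective letter_exp.
Proof.
have ip := expnI (prime_gt1 (pcharf_prime pK)).
have q0 k : (p ^ k)%N <> 0%N by move=> e; have := expn_gt0 p k; rewrite e p_gt0.
move=> [[] k] [[] k'] /=; rewrite /letter_exp /=.
- by case=> /ip ->.
- by case=> e; case: (q0 k').
- by case=> e; case: (q0 k).
- by case=> /ip ->.
Qed.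


(** * Coordinates with respect to the words of [M] *)

Local Notation word_val := (word_val iota p phi).
Local Notation poly_val := (poly_val iota p phi).
Local Notation M_coord := (M_coord iota p phi).
Local Notation split_last := (split_last iota p phi).
Local Notation d1_basis := (d1_basis iota p phi).

Let poly_val_morph w : {morph (fun c : K => c *: word_val w) : x y / x + y}.
Proof. by move=> a b; rewrite scalerDl. Qed.

Lemma coef_poly_val f m :
  coef (poly_val f) m = \sum_(w <- msupp f) f@_w * word_op K p w m.
Proof.
rewrite /Defs.poly_val coef_sum; apply: eq_bigr => w _.
by rewrite coefZ coef_word.
Qed.

Lemma M_free (f : {malg K[word]}) :
  (forall w, w \in msupp f -> M p K w) -> poly_val f = 0 -> f = 0.
Proof.
move=> fM f0; have pp := pcharf_prime pK.
(* One more than the highest level that occurs, so all words of the support are normal words with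
   the same number of levels. *)
pose n := (\max_(w <- msupp f) \max_(x <- (w : seq letter)) x.2).+1.
have hn (w : word) : w \in msupp f -> all (fun x : letter => 0 <= x.2 < 0 + n)%N w.
  move=> wf; apply/allP => x xw; rewrite leq0n add0n ltnS /=.
  apply: (@leq_trans (\max_(x <- (w : seq letter)) x.2)).
    exact: (leq_bigmax_seq _ xw).
  exact: (leq_bigmax_seq _ wf).
have /choice[mm mmE] (w : word) : exists m, w \in msupp f ->
    [&& m.1.1 < p ^ n, m.1.2 < p ^ n & m.2 < p ^ n]%N /\
    (w : seq letter) = normal_word p n 0 m.
  case: (boolP (w \in msupp f)) => wf; last by exists exp0.
  have [m hm] := reduced_normal pp (M_reduced pp (fM _ wf)) (hn _ wf).
  by exists m.
have wE (w : word) : w \in msupp f -> FMonom (normal_word p n 0 (mm w)) = w.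
  by move=> wf; rewrite -(proj2 (mmE w wf)) fmK.
pose r := [seq mm w | w <- msupp f].
pose c m := f@_(FMonom (normal_word p n 0 m)).
have cE w : w \in msupp f -> c (mm w) = f@_w by move=> /wE; rewrite /c => ->.
apply/malgP => w; rewrite mcoeff0; case: (boolP (w \in msupp f)); last first.
  by move/mcoeff_outdom.
move=> wf; rewrite -(cE w wf).
apply: (normal_words_free pK (n := n) (r := r) (c := c)); last exact: map_f.
- rewrite map_inj_in_uniq ?fset_uniq // => w1 w2 w1f w2f e.
  by rewrite -(wE _ w1f) -(wE _ w2f) e.
- by move=> m /mapP[w1 w1f ->]; have [] := mmE w1 w1f.
- move=> m; rewrite big_map -[RHS](coef0 m) -f0 coef_poly_val.
  rewrite big_seq [RHS]big_seq; apply: eq_bigr => w1 w1f.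
  by rewrite (cE _ w1f) -(proj2 (mmE w1 w1f)).
Qed.

(** The alternative [M_coord v = 0] covers the default value of [xget]. *)
Lemma M_coordP v : (forall w, w \in msupp (M_coord v) -> M p K w) /\
  (poly_val (M_coord v) = v \/ M_coord v = 0).
Proof.
rewrite /Defs.M_coord; case: xgetP => [f _ [fM fv]|_]; first by split=> //; left.
by split; [move=> w; rewrite msupp0 in_fset0 | right].
Qed.

Lemma homog_sum r I (s : seq I) (P : pred I) (f : I -> A) :
  (forall i, P i -> homog r (f i)) -> homog r (\sum_(i <- s | P i) f i).
Proof.
move=> hf; elim/big_rec: _ => [|i a Pi ha]; first exact: homog0.
by apply: homogD => //; exact: hf.
Qed.

(* This is where the linear independence of [M] is used: the coordinates of a
   homogeneous element only involve words of its degree. *)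
Lemma M_coord_homog r v w : homog r v -> w \in msupp (M_coord v) -> word_deg p w = r.
Proof.
move=> hv wf; have [fM [fv|f0]] := M_coordP v; last first.
  by move: wf; rewrite f0 msupp0 in_fset0.
move: (M_coord v) wf fM fv => f wf fM fv; apply/eqP.
(* The part of [f] outside degree [r]. Its value vanishes at exponents of degree [r] for reasons of
   degree, and at all others because it agrees there with [v]; so [M_free] applies. *)
pose f' : {malg K[word]} :=
  \sum_(w <- msupp f | word_deg p w != r) << f@_w *g w >>.
have f'E u : f'@_u = if word_deg p u != r then f@_u else 0.
  rewrite /f' raddf_sum /=; case: (boolP (u \in msupp f)) => uf.
    rewrite -big_filter; case: ifP => ur.
      rewrite (bigD1_seq u) ?mem_filter ?ur ?filter_uniq //= mcoeffUU.
      by rewrite big1 ?addr0 // => u' u'u; rewrite mcoeffU (negbTE u'u).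
    rewrite big1_seq // => u' /andP[_]; rewrite mem_filter => /andP[u'r _].
    by rewrite mcoeffU; case: eqP => // u'u; rewrite -u'u u'r in ur.
  rewrite (mcoeff_outdom uf) if_same big1_seq // => u' /andP[_ u'f].
  by rewrite mcoeffU; case: eqP => // u'u; rewrite -u'u u'f in uf.
have f'f : (msupp f' `<=` msupp f)%fset.
  apply/fsubsetP => u; rewrite -!mcoeff_neq0 f'E.
  by case: ifP => // _; rewrite eqxx.
have f'0 : f' = 0.
  apply: M_free => [u /(fsubsetP f'f)/fM//|].
  apply: coef_inj => m; rewrite coef0.
  have -> : poly_val f' = \sum_(w <- msupp f | word_deg p w != r) f@_w *: word_val w.
    rewrite -[LHS]/(malg_sum (fun w c => c *: word_val w) f').
    rewrite malg_sum_sum; last exact: poly_val_morph.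
    by apply: eq_bigr => u _; rewrite malg_sumU //; exact: poly_val_morph.
  have [mr|mr] := eqVneq (exp_deg m) r.
    rewrite -big_filter coef_sum big1_seq // => u; rewrite mem_filter => /and3P[_ ur _].
    by rewrite coefZ (homog_word (w := u)) ?mulr0 // mr eq_sym.
  have := hv m mr; rewrite -fv /Defs.poly_val.
  rewrite (bigID (fun w => word_deg p w != r)) /= coefD.
  rewrite [X in _ + X](_ : _ = 0) ?addr0 //.
  suff : homog r (\sum_(i <- msupp f | ~~ (word_deg p i != r)) f@_i *: word_val i).
    by apply.
  apply: homog_sum => u; rewrite negbK => /eqP <-.
  exact/homogZ/homog_word.
apply: contraTT wf => wr; rewrite -mcoeff_eq0.
by have := f'E w; rewrite wr f'0 mcoeff0 => <-.
Qed.

(** Among all words only [x] itself has a component at [letter_exp x], so a coordinate vector that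
    represents [v] has there the coefficient of [x]. *)
Lemma M_coord_letter (x : letter) v : coef v (letter_exp x) = 0 ->
  (M_coord v)@_(FMonom [:: x]) = 0.
Proof.
move=> vx; have [_ [fv|->]] := M_coordP v; last by rewrite mcoeff0.
move: vx; rewrite -{1}fv coef_poly_val.
case: (boolP (FMonom [:: x] \in msupp (M_coord v))) => xf; last first.
  by move=> _; exact: mcoeff_outdom.
rewrite (big_fsetD1 _ xf) big1_fset => [|w]; last first.
  rewrite in_fsetD1 => /andP[wx _] _.
  case: w wx => [[|y [|z s]]] wx; last by rewrite word_op_letter ?mulr0.
    rewrite /= /coord1 -[exp0]/(exp0) /letter_exp.
    have q0 : (p ^ x.2 == 0)%N = false by rewrite expn_eq0 eqn0Ngt p_gt0.
    by case: x.1; rewrite !xpair_eqE ?q0 ?andbF ?mulr0.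
  have yx : y != x by apply: contra wx => /eqP ->.
  rewrite -coef_word /Defs.word_val /= big_seq1 letter_valE coefE.
  by rewrite (inj_eq letter_exp_inj) (negbTE yx) mulr0.
rewrite -coef_word /Defs.word_val /= big_seq1 letter_valE coefE eqxx mulr1.
by rewrite addr0.
Qed.


(** * Smallness of the image of [d0] *)

Local Notation lv := (letter_val iota p phi).
Local Notation d0 := (d0 iota p phi).
Local Notation d1 := (d1 iota (p := p) phi).
Local Notation free_homog := (free_deg iota phi (letter_deg p)).

Lemma coef_sum_neq0 (s : seq A) m :
  coef (\sum_(w <- s) w) m != 0 -> exists2 w, w \in s & coef w m != 0.
Proof.
rewrite coef_sum => sm; have /hasP[w ws wm] : has (fun w => coef w m != 0) s.
  apply: contraNT sm => /hasPn sm; rewrite big1_seq // => w /andP[_ /sm].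
  by rewrite negbK => /eqP.
by exists w.
Qed.

Let d0D x : {morph (fun c : A => c *: (lv x : A^o)) : a b / a + b}.
Proof. by move=> a b; rewrite scalerDl. Qed.

Let d0Z x (a c : A) : (a * c) *: (lv x : A^o) = a *: (c *: (lv x : A^o)).
Proof. by rewrite scalerA. Qed.

Lemma d0_linear (a : A) u v : d0 (a *: u + v) = a *: d0 u + d0 v.
Proof.
rewrite -![d0 _]/(malg_sum (fun x c => c *: (lv x : A^o)) _).
by rewrite malg_sumD // malg_sumZ.
Qed.

Lemma d0U a x : d0 << a *g x >> = a * lv x.
Proof. by rewrite -[LHS]/(malg_sum (fun x c => c *: (lv x : A^o)) _) malg_sumU. Qed.

Lemma d0_graded : graded_submodule (P := A^o) (A_deg iota phi) (range d0).
Proof.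
have d00 : d0 0 = 0 by rewrite /Defs.d0 msupp0 big_seq_fset0.
split; first by exists 0.
  move=> a _ _ [u _ <-] [v _ <-]; exists (a *: u + v) => //.
  exact: d0_linear.
move=> _ [v _ <-].
change (homog_sums (P := A^o) (A_deg iota phi) (range d0)
  (\sum_(x <- msupp v) v@_x *: (lv x : A^o))).
apply: homog_sums_sum => x; rewrite -[_ *: _]/(v@_x * lv x) {1}[v@_x]g_span mulr_suml.
apply: homog_sums_sum => m.
apply: (@homog_sums1 _ _ _ _ _ (exp_deg m + letter_deg p x)).
  by exists << (g v@_x)@_m *: E m *g x >> => //; rewrite d0U.
apply/A_degP/homogM; last exact: homog_letter.
by apply: homogZ; exact: homogE.
Qed.

Lemma coef_d0 v : coef (d0 v) exp0 = 0.
Proof.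
rewrite /Defs.d0 coef_sum big1 // => x _; apply: coefM0.
rewrite letter_valE coefE /letter_exp.
have q0 : (p ^ x.2 == 0)%N = false by rewrite expn_eq0 eqn0Ngt p_gt0.
by case: x.1; rewrite !xpair_eqE ?q0 ?andbF.
Qed.

(** The image lies in the augmentation ideal, so writing 1 as an element of [T] plus an element of
    the image produces in [T] an element with nonzero constant term. *)
Lemma d0_small : small (P := A^o) (A_deg iota phi) (range d0).
Proof.
split; first exact: d0_graded.
move=> T gT TN v; have [t [_ [Tt [u _ <-] e1]]] := TN 1.
have : coef t exp0 != 0.
  have := coef1 exp0; rewrite e1 coefD coef_d0 addr0 => ->.
  by rewrite /coord1 eqxx oner_neq0.
(* The homogeneous summands need not have distinct degrees; one with nonzero constant term is
   selected, and it is a scalar. *)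
have [_ _ /(_ t Tt)[s [hs ->]]] := gT.
move=> /coef_sum_neq0[w /hs[Tw [d /A_degP hw]] w0].
have wE : w = (coef w exp0)%:A.
  apply: homog_scalar; suff <- : d = 0 by [].
  by apply/eqP; apply: contraNT w0 => dn; rewrite hw // eq_sym.
have T1 : T 1.
  have -> : 1 = (coef w exp0)^-1%:A * w.
    by rewrite {2}wE -scalerAl mul1r scalerA mulVf // scale1r.
  exact: (graded_submoduleZ gT).
rewrite -[v]mulr1; exact: (graded_submoduleZ gT).
Qed.

(** * The grading of [P_0] and smallness of the image of [d1] *)

Lemma free_homog0 s : free_homog s 0.
Proof. by move=> x; left; rewrite mcoeff0. Qed.

Lemma degI (r r' d : nat * nat) : r + d = r' + d -> r = r'.
Proof.
by case: r r' d => [a b] [a' b'] [c c'] [] /addIn -> /addIn ->.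
Qed.

(** [free_deg] asks for a degree [r] in each component separately; cancellation in the degree monoid
    makes the two choices agree. *)
Lemma free_homogD s u v : free_homog s u -> free_homog s v -> free_homog s (u + v).
Proof.
move=> hu hv x; rewrite mcoeffD.
case: (hu x) => [->|[r rs Hr]]; first by rewrite add0r; exact: hv.
right; exists r => //; apply/A_degP/homogD; first exact/A_degP.
case: (hv x) => [->|[r' rs' /A_degP Hr']]; first exact: homog0.
by have <- : r' = r by apply: (@degI _ _ (letter_deg p x)); rewrite rs' rs.
Qed.

Lemma free_homogZ r s a v : homog r a -> free_homog s v -> free_homog (r + s) (a *: v).
Proof.
move=> ha hv x; rewrite mcoeffZ; case: (hv x) => [->|[r' rs Hr]].
  by left; rewrite mulr0.
right; exists (r + r'); first by rewrite -addrA rs.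
by apply/A_degP/homogM => //; exact/A_degP.
Qed.

Lemma free_homogZ0 s c v : free_homog s v -> free_homog s (c%:A *: v).
Proof.
move=> hv; rewrite -[s]add0r; apply: free_homogZ => //; apply: homogZ.
by have := @homogE exp0; rewrite (phi_pbw0 ext).
Qed.

Lemma split_last_homog (w : word) : free_homog (word_deg p w) (split_last w).
Proof.
case: w => [[|x s]]; first by move=> y; left; rewrite mcoeff0.
move=> y; rewrite /Defs.split_last /= mcoeffU; case: eqP => [<-|_]; last by left.
right; exists (word_deg p (FMonom (belast x s))); last exact/A_degP/homog_word.
by rewrite /word_deg /= (lastI x s) -cats1 big_cat big_seq1.
Qed.

Lemma poly_valU t : poly_val << t >> = word_val t.
Proof.
rewrite -[LHS]/(malg_sum (fun w c => c *: word_val w) << t >>).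
by rewrite malg_sumU ?scale1r //; exact: poly_val_morph.
Qed.

Lemma poly_val0 : poly_val 0 = 0.
Proof. by rewrite /Defs.poly_val msupp0 big_seq_fset0. Qed.

Lemma d1_basis_homog (t : word) : free_homog (word_deg p t) (d1_basis t).
Proof.
set v := poly_val (NF iota p phi << t >>).
have hv : homog (word_deg p t) v.
  rewrite /v /NF poly_valU; have [_ [->|->]] := M_coordP (word_val t).
    exact: homog_word.
  by rewrite poly_val0; exact: homog0.
rewrite /Defs.d1_basis -/v; apply: free_homogD; first exact: split_last_homog.
have -> : - i0 iota p phi v = (-1)%:A *: i0 iota p phi v :> {malg A[letter]}.
  by rewrite !scaleN1r.
apply: free_homogZ0; rewrite /i0 big_seq.
elim/big_ind: _ => [|u u'|w wv]; [exact: free_homog0|exact: free_homogD|].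
by rewrite -(M_coord_homog hv wv); apply: free_homogZ0; exact: split_last_homog.
Qed.

Lemma split_last_coef0 (w : word) x :
  coef (split_last w)@_x exp0 = (w == FMonom [:: x])%:R.
Proof.
case: w => [[|y s]]; first by rewrite mcoeff0 coef0.
rewrite /Defs.split_last /= mcoeffU; case: s => [|z s] /=.
  have -> : word_val (FMonom [::]) = 1 by rewrite /Defs.word_val big_nil.
  have -> : (FMonom [:: y] == FMonom [:: x]) = (y == x).
    by apply/eqP/eqP => [[]|->].
  by case: eqP => _; rewrite ?coef0 // coef1 /coord1 eqxx.
have -> : (FMonom [:: y, z & s] == FMonom [:: x]) = false by apply/eqP.
by case: eqP => _; rewrite ?coef0 // coef_word word_op0.
Qed.

Lemma d1_basis_coef0 (t : word) x : (1 < size t)%N ->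
  coef (d1_basis t)@_x exp0 = 0.
Proof.
move=> st; rewrite /Defs.d1_basis mcoeffB coefD coefN split_last_coef0.
have -> : (t == FMonom [:: x]) = false by apply: contraTF st => /eqP ->.
have vx : coef (poly_val (NF iota p phi << t >>)) (letter_exp x) = 0.
  rewrite /NF poly_valU; have [_ [->|->]] := M_coordP (word_val t); last first.
    by rewrite poly_val0 coef0.
  by rewrite coef_word; case: t st => [[|y s]] // st; exact: word_op_letter.
move: (poly_val _) vx => v vx.
rewrite /i0 raddf_sum /= coef_sum sub0r.
have -> : \sum_(w <- msupp (M_coord v))
    coef (((M_coord v)@_w)%:A *: split_last w)@_x exp0 =
  \sum_(w <- msupp (M_coord v)) (M_coord v)@_w * (w == FMonom [:: x])%:R.
  apply: eq_bigr => w _.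
  by rewrite mcoeffZ -scalerAl mul1r coefZ split_last_coef0.
rewrite big1 ?oppr0 // => w _; case: eqP => [->|_]; last by rewrite mulr0.
by rewrite M_coord_letter // mul0r.
Qed.

Let d1D (t : T1 p K) : {morph (fun c : A => c *: d1_basis (val t)) : a b / a + b}.
Proof. by move=> a b; rewrite scalerDl. Qed.

Let d1Z (t : T1 p K) (a c : A) :
  (a * c) *: d1_basis (val t) = a *: (c *: d1_basis (val t)).
Proof. by rewrite scalerA. Qed.

Lemma d1_linear (a : A) u v : d1 (a *: u + v) = a *: d1 u + d1 v.
Proof.
rewrite -![d1 _]/(malg_sum (fun (t : T1 p K) c => c *: d1_basis (val t)) _).
by rewrite malg_sumD // malg_sumZ.
Qed.

Lemma d1U a t : d1 << a *g t >> = a *: d1_basis (val t).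
Proof.
by rewrite -[LHS]/(malg_sum (fun (t : T1 p K) c => c *: d1_basis (val t)) _) malg_sumU.
Qed.

Lemma T1_valP (t : T1 p K) : T1 p K (val t).
Proof. exact/set_mem/valP. Qed.

Lemma d1_graded : graded_submodule (P := {malg A[letter]}) free_homog (range d1).
Proof.
have d10 : d1 0 = 0 by rewrite /Defs.d1 msupp0 big_seq_fset0.
split; first by exists 0.
  move=> a _ _ [u _ <-] [v _ <-]; exists (a *: u + v) => //.
  exact: d1_linear.
move=> _ [v _ <-].
change (homog_sums (P := {malg A[letter]}) free_homog (range d1)
  (\sum_(t <- msupp v) v@_t *: d1_basis (val t))).
apply: homog_sums_sum => t; rewrite {1}[v@_t]g_span scaler_suml.
apply: homog_sums_sum => m.
apply: (@homog_sums1 _ _ _ _ _ (exp_deg m + word_deg p (val t))).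
  by exists << (g v@_t)@_m *: E m *g t >> => //; rewrite d1U.
apply: free_homogZ; last exact: d1_basis_homog.
by apply: homogZ; exact: homogE.
Qed.

Lemma d1_coef0 v x : coef (d1 v)@_x exp0 = 0.
Proof.
rewrite /Defs.d1 raddf_sum /= coef_sum big1 // => t _.
rewrite mcoeffZ; apply/coefM0/d1_basis_coef0.
exact: (T1_size (pcharf_prime pK) (T1_valP t)).
Qed.

(** The letters that can accompany [x] in a homogeneous element of degree [letter_deg p x] have
    lower level; this drives the induction on levels in [d1_small]. *)
Lemma letter_degE x y r : r + letter_deg p y = letter_deg p x -> y != x ->
  y.1 = x.1 /\ (y.2 < x.2)%N.
Proof.
have q0 k : (0 < p ^ k)%N by rewrite expn_gt0 p_gt0.
have le_pexp (b : bool) k k' a : (a + p ^ k' = p ^ k)%N ->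
    (b, k') != (b, k) -> (k' < k)%N.
  move=> e; rewrite xpair_eqE eqxx /= => ne; rewrite ltn_neqAle ne /=.
  by rewrite -(leq_exp2l _ _ (prime_gt1 (pcharf_prime pK))) -e leq_addl.
case: r x y => [a c] [b k] [b' k'] e.
have {e} [/= e1 e2] : (a + (letter_deg p (b', k')).1 = (letter_deg p (b, k)).1)%N
    /\ (c + (letter_deg p (b', k')).2 = (letter_deg p (b, k)).2)%N.
  by split; [exact: (congr1 fst e) | exact: (congr1 snd e)].
move: e1 e2; rewrite /letter_deg /=; case: b b' => [] [] /= e1 e2 ne.
- by split=> //; exact: le_pexp e2 ne.
- by move/eqP: e1; rewrite addn_eq0 (gtn_eqF (q0 k')) andbF.
- by move/eqP: e2; rewrite addn_eq0 (gtn_eqF (q0 k')) andbF.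
- by split=> //; exact: le_pexp e1 ne.
Qed.

(* Nakayama: a homogeneous element of degree [deg x] whose component at [.x]
   is not in the augmentation ideal is [c.x] plus terms at lower letters. *)
Lemma d1_small :
  small (P := {malg A[letter]}) free_homog (range d1).
Proof.
split; first exact: d1_graded.
move=> T gT TN.
suff Tx x : T << (1 : A) *g x >>.
  move=> v; rewrite [v]monalgE; apply: (graded_submodule_sum gT) => x _.
  have -> : << v@_x *g x >> = v@_x *: << (1 : A) *g x >>.
    by apply/malgP => y; rewrite mcoeffZ !mcoeffU mulrnAr mulr1.
  exact: (graded_submoduleZ gT).
have [n] := ubnP x.2; elim: n x => // n IH x; rewrite ltnS => xn.
have [t [_ [Tt [u _ <-] e]]] := TN << (1 : A) *g x >>.
have tx : coef t@_x exp0 != 0.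
  have := congr1 (fun v : {malg A[letter]} => coef v@_x exp0) e.
  rewrite mcoeffUU mcoeffD coefD d1_coef0 addr0 => <-.
  by rewrite coef1 /coord1 eqxx oner_neq0.
have [_ _ /(_ t Tt)[s [hs tE]]] := gT.
have [w ws wx] : exists2 w, w \in s & coef w@_x exp0 != 0.
  have sumE : t@_x = \sum_(a <- [seq w@_x | w <- s]) a by rewrite tE raddf_sum big_map.
  move: tx; rewrite sumE => /coef_sum_neq0[_ /mapP[w ws ->]]; by exists w.
have [Tw [d hw]] := hs w ws.
have [r0 wxE] : d = letter_deg p x /\ w@_x = (coef w@_x exp0)%:A.
  case: (hw x) => [w0|[r rd /A_degP hr]]; first by rewrite w0 coef0 eqxx in wx.
  have r0 : r = 0.
    by apply/eqP; apply: contraNT wx => rn; rewrite hr // eq_sym.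
  by rewrite -rd r0 add0r; split=> //; apply: homog_scalar; rewrite -r0.
set c := coef _ _ in wx wxE.
have -> : << (1 : A) *g x >> =
    (c^-1)%:A *: (w - \sum_(y <- msupp w | y != x) << w@_y *g y >>).
  have xw : x \in msupp w.
    rewrite -mcoeff_neq0; apply: contraNneq wx => w0; rewrite /c w0.
    by rewrite coef0.
  rewrite {1}[w]monalgE (bigD1_seq x) ?fset_uniq //= addrK wxE.
  apply/malgP => y; rewrite mcoeffZ !mcoeffU; case: eqP => _; last by rewrite mulr0.
  by rewrite -scalerAl mul1r scalerA mulVf // scale1r.
apply: (graded_submoduleZ gT); apply: (graded_submoduleB gT) => //.
apply: (graded_submodule_sum gT) => y yx.
have -> : << w@_y *g y >> = w@_y *: << (1 : A) *g y >>.
  by apply/malgP => z; rewrite mcoeffZ !mcoeffU mulrnAr mulr1.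
case: (hw y) => [->|[r rd _]].
  by rewrite scale0r; exact: (graded_submodule0 gT).
apply: (graded_submoduleZ gT); apply: IH.
rewrite r0 in rd; have [_ yx2] := letter_degE rd yx.
exact: leq_trans yx2 xn.
Qed.

End AlgebraCoordinates.

Theorem corollary3 (R : realType) (U : algType R[i])
    (iota : {linear sl3p R[i] -> U}) (K : fieldType) (p : nat)
    (A : algType K) (phi : U -> A) :
  is_enveloping iota ->
  p \in [pchar K] ->
  is_scalar_extension iota phi ->
  small (P := A^o) (A_deg iota phi) (range (d0 iota p phi)) /\
  small (P := {malg A[letter]}) (free_deg iota phi (letter_deg p))
    (range (d1 iota (p := p) phi)).
Proof.
move=> env pK ext; have [g [g_pbw g_span]] := coordinates env ext.
split; first exact: (d0_small env ext pK g_pbw g_span).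
exact: (d1_small env ext pK g_pbw g_span).
Qed.
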